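(* For every $k>0$ there is a non-trivial $K$-linear relation in $\mathcal Z_{q^k+1,\emptyset}(K)$ of the form $$\zeta_A(1,1,q-1,\dots,q^{k-1}(q-1))+\frac{(-1)^{k+1}}{D_k}\zeta_A(1,q^k)+\Xi_k=0,$$ where $\Xi_k\in\mathcal Z_{q^k+1,\emptyset}(K)$ is given by the series $$\Xi_k=\frac1{D_k}\sum_{j=1}^k(-1)^{k+j}D_j^{q^{k-j}}\sum_{d\ge0}S_d(1)\,S_d\big(q^{k-j},q^{k-j}(q-1),\dots,q^{k-1}(q-1)\big).$$
   Context: $p$ is a prime, $q=p^e$, $A=\mathbb F_q[\theta]$, $K=\mathbb F_q(\theta)$, $K_\infty=\mathbb F_q((1/\theta))$, $A^+$ is the set of monic polynomials in $A$. $D_i=\prod_{j=0}^{i-1}(\theta^{q^i}-\theta^{q^j})$. For positive integers $n_1,\dots,n_r$ and $d\ge0$, $$S_d(n_1,\dots,n_r)=\sum_{a_1,\dots,a_r\in A^+,\ d=\deg a_1>\deg a_2>\cdots>\deg a_r}\frac1{a_1^{n_1}\cdots a_r^{n_r}},\qquad \zeta_A(n_1,\dots,n_r)=\sum_{d\ge0}S_d(n_1,\dots,n_r)\in K_\infty$$ (Thakur's multiple zeta values, of weight $n_1+\cdots+n_r$). $\mathcal Z_{n,\emptyset}(K)\subset K_\infty$ is the $K$-vector space spanned by the $\zeta_A(n_1,\dots,n_r)$ of weight $n$. In $(1,1,q-1,\dots,q^{k-1}(q-1))$ the entries after the two $1$'s are $q^i(q-1)$ for $0\le i\le k-1$; in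 $(q^{k-j},q^{k-j}(q-1),\dots,q^{k-1}(q-1))$ the entries after $q^{k-j}$ are $q^i(q-1)$ for $k-j\le i\le k-1$. *)

(* Defs.v *)
From HB Require Import structures.
From mathcomp Require Import all_boot all_order all_algebra.
From mathcomp Require Import all_classical topology sequences.
From mathcomp Require Import xfinmap monalg.

Set Implicit Arguments.
Unset Strict Implicit.
Unset Printing Implicit Defensive.

Import GRing.Theory.

Local Open Scope classical_set_scope.
Local Open Scope ring_scope.

Section PowerSeries.
Variable F : fieldType.

Record fps := Fps { fps_coef :> nat -> F }.

Implicit Types f g h : fps.

Lemma fpsP f g : (forall n, f n = g n) -> f = g.
Proof. by case: f g => [f] [g] /= /funext ->. Qed.

HB.instance Definition _ := gen_eqMixin fps.
HB.instance Definition _ := gen_choiceMixin fps.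

Definition fpsC (c : F) := Fps (fun n => if n is 0%N then c else 0).
Definition fpsX := Fps (fun n => (n == 1%N)%:R).
Definition fps_opp f := Fps (fun n => - f n).
Definition fps_add f g := Fps (fun n => f n + g n).
Definition fps_mul f g := Fps (fun n => \sum_(i < n.+1) f i * g (n - i)%N).

Lemma fps_addA : associative fps_add.
Proof. by move=> f g h; apply: fpsP => n /=; rewrite addrA. Qed.
Lemma fps_addC : commutative fps_add.
Proof. by move=> f g; apply: fpsP => n /=; rewrite addrC. Qed.
Lemma fps_add0 : left_id (fpsC 0) fps_add.
Proof. by move=> f; apply: fpsP => -[|n] /=; rewrite add0r. Qed.
Lemma fps_addN : left_inverse (fpsC 0) fps_opp fps_add.
Proof. by move=> f; apply: fpsP => -[|n] /=; rewrite addNr. Qed.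

HB.instance Definition _ :=
  GRing.isZmodule.Build fps fps_addA fps_addC fps_add0 fps_addN.

Definition fps_trunc N f : {poly F} := \poly_(i < N) f i.

Lemma fps_mulE N f g n :
  (n < N)%N -> fps_mul f g n = (fps_trunc N f * fps_trunc N g)`_n.
Proof.
move=> ltnN; rewrite coefM /=; apply: eq_bigr => i _.
by rewrite !coef_poly (leq_ltn_trans _ ltnN) ?leq_ord//
  (leq_ltn_trans _ ltnN) ?leq_subr.
Qed.

Lemma fps_mulC : commutative fps_mul.
Proof. by move=> f g; apply: fpsP => n; rewrite !(fps_mulE _ _ (ltnSn n)) mulrC. Qed.

Lemma fps_mulA : associative fps_mul.
Proof.
suff H f g h n : fps_mul (fps_mul f g) h n =
    (fps_trunc n.+1 f * fps_trunc n.+1 g * fps_trunc n.+1 h)`_n.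
  move=> f g h; apply: fpsP => n; rewrite H fps_mulC H.
  by rewrite mulrC mulrA.
rewrite coefM; apply: eq_bigr => i _; rewrite coef_poly ltnS leq_subr.
by rewrite -fps_mulE.
Qed.

Lemma fps_mul1 : left_id (fpsC 1) fps_mul.
Proof.
move=> f; apply: fpsP => n /=; rewrite big_ord_recl /= mul1r subn0.
by rewrite big1 ?addr0// => i _; rewrite mul0r.
Qed.

Lemma fps_mulDl : left_distributive fps_mul fps_add.
Proof.
move=> f g h; apply: fpsP => n /=; rewrite -big_split /=.
by apply: eq_bigr => i _; rewrite mulrDl.
Qed.

Lemma fps_oner_neq0 : fpsC 1 != 0.
Proof. by apply/eqP => /(congr1 (fun f : fps => f 0%N))/eqP; rewrite /= oner_eq0. Qed.

HB.instance Definition _ := GRing.Zmodule_isComNzRing.Build fps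
  fps_mulA fps_mulC fps_mul1 fps_mulDl fps_oner_neq0.

Lemma fps_coef0 n : (0 : fps) n = 0. Proof. by case: n. Qed.
Lemma fps_coefD f g n : (f + g) n = f n + g n. Proof. by []. Qed.
Lemma fps_coefN f n : (- f) n = - f n. Proof. by []. Qed.
Lemma fps_coefM f g n : (f * g) n = \sum_(i < n.+1) f i * g (n - i)%N.
Proof. by []. Qed.

Lemma fps_coef_sum (I : Type) (r : seq I) (P : pred I) (f : I -> fps) n :
  (\sum_(i <- r | P i) f i) n = \sum_(i <- r | P i) f i n.
Proof.
by elim/big_ind2: _ => [|a b c d <- <-|//]; rewrite ?fps_coef0 ?fps_coefD.
Qed.

Lemma fps_coefXM f n : (fpsX * f) n = if n is m.+1 then f m else 0.
Proof.
case: n => [|n]; rewrite fps_coefM; first by rewrite big_ord1 mul0r.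
rewrite big_ord_recl mul0r add0r big_ord_recl /= mul1r subSS subn0.
by rewrite big1 ?addr0// => i _; rewrite mul0r.
Qed.

Lemma fps_coefXnM N f n :
  (fpsX ^+ N * f) n = if (n < N)%N then 0 else f (n - N)%N.
Proof.
elim: N n => [|N IH] n; first by rewrite mul1r subn0.
by rewrite exprS -mulrA fps_coefXM; case: n => [|n]; rewrite ?IH.
Qed.

(* the recursion g_n = - f_0^-1 * sum_(1 <= i <= n) f_i g_(n-i), g_0 = f_0^-1 *)
Fixpoint fps_inv_seq f n : seq F :=
  if n is m.+1 then
    let s := fps_inv_seq f m in
    rcons s (- (f 0%N)^-1 * \sum_(i < m.+1) f i.+1 * s`_(m - i))
  else [:: (f 0%N)^-1].
Definition fps_inv f := Fps (fun n => (fps_inv_seq f n)`_n).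

Lemma size_fps_inv_seq f n : size (fps_inv_seq f n) = n.+1.
Proof. by elim: n => //= n IH; rewrite size_rcons IH. Qed.

Lemma nth_fps_inv_seq f n m : (m <= n)%N -> (fps_inv_seq f n)`_m = fps_inv f m.
Proof.
elim: n => [|n IH]; first by rewrite leqn0 => /eqP->.
rewrite leq_eqVlt ltnS => /predU1P[->//|lemn].
by rewrite /= nth_rcons size_fps_inv_seq ltnS lemn IH.
Qed.

Lemma fps_mulVf f : f 0%N != 0 -> fps_inv f * f = 1.
Proof.
move=> f0; rewrite mulrC; apply: fpsP => -[|n]; rewrite fps_coefM.
  by rewrite big_ord1 /= mulfV.
rewrite big_ord_recl subn0.
have -> : fps_inv f n.+1 =
    - (f 0%N)^-1 * \sum_(i < n.+1) f i.+1 * fps_inv f (n - i)%N.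
  rewrite [LHS]/= nth_rcons size_fps_inv_seq ltnn eqxx; congr (_ * _).
  by apply: eq_bigr => i _; rewrite nth_fps_inv_seq ?leq_subr.
rewrite mulrA mulrN mulfV// mulN1r; apply/eqP; rewrite addrC subr_eq0; apply/eqP.
by apply: eq_bigr.
Qed.

Definition fps_unit : pred fps := fun f => f 0%N != 0.
Definition fps_invr f := if fps_unit f then fps_inv f else f.

Lemma fps_mulVx : {in fps_unit, left_inverse 1 fps_invr *%R}.
Proof. by move=> f uf; rewrite /fps_invr ifT// fps_mulVf. Qed.
Lemma fps_unitPl f g : g * f = 1 -> fps_unit f.
Proof.
move=> /(congr1 (fun h : fps => h 0%N)); rewrite fps_coefM big_ord1 /= => H.
by apply: contraTneq isT => f0; move: H => /eqP; rewrite f0 mulr0 eq_sym oner_eq0.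
Qed.
Lemma fps_invr_out : {in [predC fps_unit], fps_invr =1 id}.
Proof. by move=> f /negbTE uf; rewrite /fps_invr ifF. Qed.

HB.instance Definition _ := GRing.ComNzRing_hasMulInverse.Build fps
  fps_mulVx fps_unitPl fps_invr_out.

Lemma fps_neq0 f : f != 0 -> exists n (g : fps), g 0%N != 0 /\ f = fpsX ^+ n * g.
Proof.
move=> f0; have /ex_minnP[n fn minn] : exists n, f n != 0.
  apply/not_existsP => H; case/eqP: f0; apply: fpsP => n.
  by rewrite fps_coef0; apply/eqP/negPn/negP/H.
exists n, (Fps (fun i => f (n + i)%N)); rewrite /= addn0; split=> //.
apply: fpsP => m; rewrite fps_coefXnM /=; case: ltnP => [ltmn|/subnKC->//].
by apply/eqP/negPn/negP => /minn; rewrite leqNgt ltmn.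
Qed.

Lemma fps_integral : GRing.integral_domain_axiom fps.
Proof.
move=> f g /eqP; apply: contraTT; rewrite negb_or.
case/andP=> /fps_neq0[n [f' [f0 ->]]] /fps_neq0[m [g' [g0 ->]]].
apply/eqP => /(congr1 (fun h : fps => h (n + m)%N))/eqP.
rewrite mulrACA -exprD fps_coefXnM ltnn subnn fps_coef0 fps_coefM big_ord1 /=.
by rewrite mulf_eq0 (negbTE f0) (negbTE g0).
Qed.

HB.instance Definition _ := GRing.ComUnitRing_isIntegral.Build fps fps_integral.

Lemma fpsC_zmod : zmod_morphism fpsC.
Proof. by move=> x y; apply: fpsP => -[|n] //=; rewrite subr0. Qed.
Lemma fpsC_monoid : monoid_morphism fpsC.
Proof.
split=> // x y; apply: fpsP => n; rewrite fps_coefM big_ord_recl subn0 big1 ?addr0.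
  by case: n => //= n; rewrite mulr0.
by move=> i _; rewrite mul0r.
Qed.
HB.instance Definition _ := GRing.isZmodMorphism.Build F fps fpsC fpsC_zmod.
HB.instance Definition _ := GRing.isMonoidMorphism.Build F fps fpsC fpsC_monoid.

End PowerSeries.

Notation "x %:F" := (FracField.tofrac x) : ring_scope.

Lemma fracE (R : idomainType) (x : {fraction R}) :
  x = (\n_(repr x))%:F / (\d_(repr x))%:F.
Proof.
have d0 : (\d_(repr x))%:F != 0 by rewrite tofrac_eq0 denom_ratioP.
apply: (mulIf d0); rewrite divfK// -{1}[x]reprK; unlock FracField.tofrac.
rewrite -[LHS]FracField.pi_mul; apply/eqmodP/eqP => /=.
rewrite /FracField.mulf !numden_Ratio ?mulf_neq0 ?oner_eq0 ?denom_ratioP//.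
by rewrite !mulr1 mulrC.
Qed.

(* F((1/theta)) as the fraction field of F[[t]], with t = 1/theta. *)
Definition Kinf (F : fieldType) := {fraction (fps F)}.
HB.instance Definition _ (F : fieldType) := GRing.Field.on (Kinf F).
HB.instance Definition _ (F : fieldType) := isPointed.Build (Kinf F) 0.

Section Kinf.
Variable F : fieldType.

Definition of_fps : fps F -> Kinf F := @FracField.tofrac (fps F).
HB.instance Definition _ := GRing.RMorphism.on of_fps.

Definition Kinf_t : Kinf F := of_fps (fpsX F).

(* The ideal t^N F[[t]], i.e. the elements of absolute value <= q^(-N); these
   form a basis of neighbourhoods of 0. *)
Definition Kinf_ideal N : set (Kinf F) := [set Kinf_t ^+ N * of_fps s | s in setT].

HB.instance Definition _ := hasNbhs.Build (Kinf F) (fun x =>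
  filter_from [set: nat] (fun N => [set y | Kinf_ideal N (y - x)])).

Lemma of_fps_eq0 s : (of_fps s == 0) = (s == 0).
Proof. exact: tofrac_eq0. Qed.

Lemma fpsX_neq0 : fpsX F != 0.
Proof. by apply/eqP => /(congr1 (fun f : fps F => f 1%N))/eqP; rewrite /= oner_eq0. Qed.

Lemma Kinf_t_neq0 : Kinf_t != 0.
Proof. by rewrite of_fps_eq0 fpsX_neq0. Qed.

Lemma Kinf_ideal0 N : Kinf_ideal N 0.
Proof. by exists 0 => //; rewrite rmorph0 mulr0. Qed.

Lemma Kinf_idealD N x y : Kinf_ideal N x -> Kinf_ideal N y -> Kinf_ideal N (x + y).
Proof. by move=> [s _ <-] [u _ <-]; exists (s + u); rewrite // rmorphD mulrDr. Qed.

Lemma Kinf_idealN N x : Kinf_ideal N x -> Kinf_ideal N (- x).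
Proof. by move=> [s _ <-]; exists (- s); rewrite // rmorphN mulrN. Qed.

Lemma Kinf_idealM N M x y :
  Kinf_ideal N x -> Kinf_ideal M y -> Kinf_ideal (N + M) (x * y).
Proof.
move=> [s _ <-] [u _ <-]; exists (s * u); rewrite // rmorphM exprD.
by rewrite mulrACA.
Qed.

Lemma Kinf_ideal_le M N x : (M <= N)%N -> Kinf_ideal N x -> Kinf_ideal M x.
Proof.
move=> /subnKC <- [s _ <-]; exists (fpsX F ^+ (N - M) * s) => //.
by rewrite rmorphM rmorphXn mulrA -exprD.
Qed.

Lemma Kinf_ideal_sum N (I : Type) (r : seq I) (P : pred I) (f : I -> Kinf F) :
  (forall i, P i -> Kinf_ideal N (f i)) -> Kinf_ideal N (\sum_(i <- r | P i) f i).
Proof.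
move=> H; elim/big_rec: _ => [|i x Pi]; first exact: Kinf_ideal0.
by apply: Kinf_idealD; apply: H.
Qed.

Lemma Kinf_separated x : (forall N, Kinf_ideal N x) -> x = 0.
Proof.
set d := \d_(repr x); set n := \n_(repr x) => H.
have d0 : d != 0 by apply: denom_ratioP.
suff n0 : n = 0 by rewrite (fracE x) -/n n0 rmorph0 mul0r.
apply: fpsP => m; have [s _ Hs] := H m.+1.
suff -> : n = fpsX F ^+ m.+1 * (s * d) by rewrite fps_coefXnM ltnSn fps_coef0.
apply/eqP; rewrite -(tofrac_eq n) !rmorphM rmorphXn mulrA; apply/eqP.
by rewrite [X in X * _]Hs [in RHS](fracE x) divfK// tofrac_eq0.
Qed.

Let Kinf_filter (x : Kinf F) : ProperFilter (nbhs x).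
Proof.
apply: filter_from_proper.
  apply: filter_from_filter; first by exists 0%N.
  move=> i j _ _; exists (maxn i j) => // y /= Hy; split.
    exact: Kinf_ideal_le (leq_maxl i j) Hy.
  exact: Kinf_ideal_le (leq_maxr i j) Hy.
by move=> N _; exists x; rewrite /= subrr; apply: Kinf_ideal0.
Qed.

Let Kinf_singleton (x : Kinf F) (A : set (Kinf F)) : nbhs x A -> A x.
Proof. by move=> [N _]; apply; rewrite /= subrr; apply: Kinf_ideal0. Qed.

Let Kinf_nbhs (x : Kinf F) (A : set (Kinf F)) :
  nbhs x A -> nbhs x (fun y => nbhs y A).
Proof.
move=> [N _ NA]; exists N => // y /= xy; exists N => // z /= yz.
by apply: NA => /=; rewrite -(subrKA y); apply: Kinf_idealD.
Qed.

HB.instance Definition _ := Nbhs_isNbhsTopological.Build (Kinf F)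
  Kinf_filter Kinf_singleton Kinf_nbhs.

Lemma Kinf_nbhsP (x : Kinf F) (A : set (Kinf F)) :
  nbhs x A <-> exists N, forall y, Kinf_ideal N (y - x) -> A y.
Proof. by split=> [[N _ H]|[N H]]; exists N. Qed.

Lemma Kinf_hausdorff : hausdorff_space (Kinf F).
Proof.
move=> x y xy; apply/eqP; rewrite -subr_eq0; apply/eqP/Kinf_separated => N.
have nbhsN (w : Kinf F) : nbhs w [set z | Kinf_ideal N (z - w)] by apply/Kinf_nbhsP; exists N.
have [z [/= xz yz]] := xy _ _ (nbhsN x) (nbhsN y).
by rewrite -(subrKA z); apply: Kinf_idealD yz; rewrite -opprB; apply: Kinf_idealN.
Qed.

Lemma Kinf_cvgP (u : nat -> Kinf F) (l : Kinf F) : (u @ \oo --> l) <->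
  (forall N, exists M, forall n, (M <= n)%N -> Kinf_ideal N (u n - l)).
Proof.
split=> [ul N|H A /Kinf_nbhsP[N NA]].
  have [|M _ HM] := ul [set y | Kinf_ideal N (y - l)].
    by apply/Kinf_nbhsP; exists N.
  by exists M => n; apply: HM.
by have [M HM] := H N; exists M => // n /= Mn; apply/NA/HM.
Qed.

Lemma Kinf_series_cvg (u : nat -> Kinf F) :
  (forall n, Kinf_ideal n (u n)) -> cvgn (series u).
Proof.
move=> Hu; have /choice[s Hs] n : exists s, u n = of_fps (fpsX F ^+ n * s).
  by have [s _ <-] := Hu n; exists s; rewrite rmorphM rmorphXn.
pose c i n := (fpsX F ^+ i * s i) n.
have c0 i n : (n < i)%N -> c i n = 0 by move=> ltni; rewrite /c fps_coefXnM ltni.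
have sE n m : (\sum_(0 <= i < n) fpsX F ^+ i * s i) m = \sum_(0 <= i < n) c i m.
  by rewrite fps_coef_sum.
clearbody c; pose f := Fps (fun n => \sum_(0 <= i < n.+1) c i n).
apply/cvg_ex; exists (of_fps f); apply/Kinf_cvgP => N; exists N => n leNn.
rewrite -opprB; apply/Kinf_idealN/(Kinf_ideal_le leNn).
exists (Fps (fun m => \sum_(n <= i < (n + m).+1) c i (n + m)%N)) => //.
rewrite /series /=; under eq_bigr do rewrite Hs.
rewrite -rmorph_sum -rmorphXn -rmorphM -rmorphB; congr of_fps.
apply: fpsP => m; rewrite fps_coefXnM fps_coefD fps_coefN sE.
have -> : f m = \sum_(0 <= i < m.+1) c i m by [].
case: ltnP => [ltmn|lenm].
  rewrite [X in _ - X](big_cat_nat _ (n := m.+1))//=.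
  have -> : \sum_(m.+1 <= i < n) c i m = 0.
    by rewrite big_nat_cond big1// => i /andP[/andP[ltmi _] _]; apply: c0.
  by rewrite addr0 subrr.
rewrite /= subnKC// [X in _ = X - _](big_cat_nat _ (n := n))//=; last exact: leqW.
by rewrite [X in _ = X - _]addrC addrK.
Qed.

(* The embedding of F[theta], 'X being the variable theta = 1/t. *)
Definition Kinf_of_poly (a : {poly F}) : Kinf F :=
  (map_poly (of_fps \o @fpsC F) a).[Kinf_t^-1].

Lemma Kinf_of_poly_zmod : zmod_morphism Kinf_of_poly.
Proof. by move=> a b; rewrite /Kinf_of_poly rmorphB hornerD hornerN. Qed.
Lemma Kinf_of_poly_monoid : monoid_morphism Kinf_of_poly.
Proof.
by split=> [|a b]; rewrite /Kinf_of_poly ?rmorph1 ?hornerC// rmorphM hornerM.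
Qed.
HB.instance Definition _ :=
  GRing.isZmodMorphism.Build {poly F} (Kinf F) Kinf_of_poly Kinf_of_poly_zmod.
HB.instance Definition _ :=
  GRing.isMonoidMorphism.Build {poly F} (Kinf F) Kinf_of_poly Kinf_of_poly_monoid.

(* a(1/t) = t^(- deg a) * (sum_i a_(deg a - i) t^i) *)
Lemma Kinf_of_polyE a : Kinf_of_poly a =
  Kinf_t ^- (size a).-1 *
  of_fps (Fps (fun n => if (n < size a)%N then a`_((size a).-1 - n) else 0)).
Proof.
have [->|a0] := eqVneq a 0.
  rewrite rmorph0 (_ : Fps _ = 0) ?rmorph0 ?mulr0//.
  by apply: fpsP => n; rewrite fps_coef0 /= size_poly0.
apply: (mulfI (expf_neq0 (size a).-1 Kinf_t_neq0)).
rewrite mulrA mulfV ?expf_neq0 ?Kinf_t_neq0// mul1r.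
have sa : size a = (size a).-1.+1 by rewrite prednK// lt0n size_poly_eq0.
rewrite /Kinf_of_poly horner_coef size_map_poly big_distrr /=.
transitivity (of_fps (\sum_(i < size a) fpsX F ^+ ((size a).-1 - i) * fpsC a`_i)).
  rewrite rmorph_sum; apply: eq_bigr => i _.
  rewrite coef_map /= rmorphM rmorphXn mulrCA mulrC; congr (_ * _).
  rewrite exprVn -expfB_cond//.
  by rewrite (negbTE Kinf_t_neq0) add0n -ltnS -sa.
congr of_fps; apply: fpsP => n.
rewrite fps_coef_sum [RHS]/=; case: ltnP => [ltn|len].
  have lt' : ((size a).-1 - n < size a)%N by rewrite [X in (_ < X)%N]sa ltnS leq_subr.
  have le_n : (n <= (size a).-1)%N by rewrite -ltnS -sa.
  rewrite (bigD1 (Ordinal lt'))// big1.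
    by rewrite [LHS]addr0 fps_coefXnM [nat_of_ord _]/= subKn// ltnn subnn.
  move=> i ne; rewrite fps_coefXnM; case: ltnP => // le1.
  case E: (n - _)%N => [|//]; case/negP: (ne : i != _); apply/eqP/val_inj => /=.
  move/eqP: E; rewrite subn_eq0 => le2.
  have -> : n = ((size a).-1 - i)%N by apply/eqP; rewrite eqn_leq le2 le1.
  by rewrite subKn// -ltnS -sa.
rewrite big1// => i _; rewrite fps_coefXnM; case: ltnP => // le1.
case E: (n - _)%N => [|//]; move/eqP: E; rewrite subn_eq0 => le2.
by have := leq_trans len (leq_trans le2 (leq_subr _ _)); rewrite {1}sa ltnn.
Qed.

Lemma Kinf_of_poly_eq0 a : (Kinf_of_poly a == 0) = (a == 0).
Proof.
apply/idP/idP => [|/eqP ->]; last by rewrite rmorph0.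
apply: contraTT => a0; rewrite Kinf_of_polyE mulf_neq0//.
  by rewrite invr_eq0 expf_neq0// Kinf_t_neq0.
rewrite of_fps_eq0; apply/eqP => /(congr1 (fun f : fps F => f 0%N))/eqP.
by rewrite /= lt0n size_poly_eq0 a0 subn0 -lead_coefE lead_coef_eq0 (negbTE a0).
Qed.

(* The extension of [Kinf_of_poly] to F(theta); the choice of the representative
   is immaterial by [Kinf_ofE]. *)
Definition Kinf_of (x : {fraction {poly F}}) : Kinf F :=
  Kinf_of_poly \n_(repr x) / Kinf_of_poly \d_(repr x).

Lemma Kinf_ofE a b : b != 0 ->
  Kinf_of (a%:F / b%:F) = Kinf_of_poly a / Kinf_of_poly b.
Proof.
move=> b0; rewrite /Kinf_of; set x := (a%:F / b%:F).
have d0 : \d_(repr x) != 0 by apply: denom_ratioP.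
apply/eqP; rewrite eqr_div ?Kinf_of_poly_eq0// -!rmorphM; apply/eqP; congr (Kinf_of_poly _).
apply/eqP; rewrite -tofrac_eq !tofracM -eqr_div ?tofrac_eq0//.
by rewrite -fracE.
Qed.

Lemma Kinf_of_tofrac a : Kinf_of a%:F = Kinf_of_poly a.
Proof. by rewrite -[a%:F]divr1 -tofrac1 Kinf_ofE ?oner_eq0// rmorph1 divr1. Qed.

Lemma Kinf_of_zmod : zmod_morphism Kinf_of.
Proof.
move=> x y; rewrite (fracE x) (fracE y).
set a := \n_(repr x); set b := \d_(repr x).
set c := \n_(repr y); set d := \d_(repr y).
have b0 : b != 0 by apply: denom_ratioP.
have d0 : d != 0 by apply: denom_ratioP.
rewrite -mulNr -tofracN addf_div ?tofrac_eq0// -!tofracM -tofracD.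
rewrite !Kinf_ofE ?mulf_neq0// -mulNr addf_div ?Kinf_of_poly_eq0//.
by rewrite rmorphD !rmorphM rmorphN.
Qed.
Lemma Kinf_of_monoid : monoid_morphism Kinf_of.
Proof.
split=> [|x y]; first by rewrite -tofrac1 Kinf_of_tofrac rmorph1.
rewrite (fracE x) (fracE y).
set a := \n_(repr x); set b := \d_(repr x).
set c := \n_(repr y); set d := \d_(repr y).
have b0 : b != 0 by apply: denom_ratioP.
have d0 : d != 0 by apply: denom_ratioP.
rewrite mulf_div -!tofracM !Kinf_ofE ?mulf_neq0//.
by rewrite mulf_div -!rmorphM.
Qed.
HB.instance Definition _ :=
  GRing.isZmodMorphism.Build {fraction {poly F}} (Kinf F) Kinf_of Kinf_of_zmod.
HB.instance Definition _ :=
  GRing.isMonoidMorphism.Build {fraction {poly F}} (Kinf F) Kinf_of Kinf_of_monoid.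

End Kinf.

Section MultipleZeta.
Variable F : finFieldType.

Local Notation A := {poly F}.
Local Notation K := {fraction {poly F}}.

Definition deg (a : A) : nat := (size a).-1.

(* {poly_(d.+1) F} is the finite type of polynomials of degree <= d. *)
Definition mzv_chain (d : nat) (a : seq {poly_(d.+1) F}) : bool :=
  let degs := [seq deg b | b : A <- map val a] in
  [&& all (fun b => (val b : A) \is monic) a,
      ohead degs == Some d & sorted gtn degs].

Definition power_sum (d : nat) (n : seq nat) : K :=
  \sum_(a : (size n).-tuple {poly_(d.+1) F} | mzv_chain a)
    (\prod_(i < size n) (val (tnth a i))%:F ^+ nth 0%N n i)^-1.

(* The limit defining the series exists by [power_sum_cvg] and is unique by
   [Kinf_hausdorff]. *)
Definition zeta (n : seq nat) : Kinf F :=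
  limn [series Kinf_of (power_sum d n)]_d.

Definition mzv_index (w : nat) (n : seq nat) : bool :=
  all (leq 1) n && (sumn n == w).

(* A formal K-linear combination of indices; a nonzero one with value 0 is a
   non-trivial linear relation between multiple zeta values. *)
Definition mzv_formal (w : nat) : set {malg K[seq nat]} :=
  [set c | forall n, n \in msupp c -> mzv_index w n].

Definition mzv_eval (c : {malg K[seq nat]}) : Kinf F :=
  \sum_(n <- msupp c) Kinf_of c@_n * zeta n.

Definition mzv_space (w : nat) : set (Kinf F) :=
  [set mzv_eval c | c in mzv_formal w].

Definition mzv_nontrivial_relation (w : nat) (c : {malg K[seq nat]}) : Prop :=
  [/\ mzv_formal w c, c != 0 & mzv_eval c = 0].

Definition carlitzD (i : nat) : A :=
  \prod_(0 <= j < i) ('X^(#|F| ^ i) - 'X^(#|F| ^ j)).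

(* q^m (q-1), ..., q^(k-1) (q-1) *)
Definition q_range (m k : nat) : seq nat :=
  [seq (#|F| ^ i * (#|F| - 1))%N | i <- index_iota m k].

Definition Xi_term (k j d : nat) : Kinf F :=
  Kinf_of (power_sum d [:: 1%N]
           * power_sum d ((#|F| ^ (k - j))%N :: q_range (k - j) k)).

Definition Xi (k : nat) : Kinf F :=
  Kinf_of ((carlitzD k)%:F)^-1 *
  \sum_(1 <= j < k.+1)
    Kinf_of ((-1) ^+ (k + j) * (carlitzD j)%:F ^+ (#|F| ^ (k - j))) *
    limn [series Xi_term k j d]_d.

Lemma Kinf_ideal_inv_monic (a : A) :
  a \is monic -> Kinf_ideal (deg a) (Kinf_of (a%:F)^-1).
Proof.
move=> mona; rewrite fmorphV /= Kinf_of_tofrac Kinf_of_polyE invfM invrK.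
set u := Fps _; exists (fps_inv u) => //; congr (_ * _).
have u0 : u 0%N != 0.
  rewrite /u /= lt0n size_poly_eq0 monic_neq0// subn0 -lead_coefE.
  by rewrite (monicP mona) oner_eq0.
have of_u0 : of_fps u != 0.
  by rewrite of_fps_eq0; apply: contra_neq u0 => ->; rewrite fps_coef0.
by apply: (mulIf of_u0); rewrite mulVf// -rmorphM fps_mulVf// rmorph1.
Qed.

Lemma Kinf_ideal_prod (I : Type) (r : seq I) (f : I -> Kinf F) :
  (forall i, Kinf_ideal 0 (f i)) -> Kinf_ideal 0 (\prod_(i <- r) f i).
Proof.
move=> H; elim/big_rec: _ => [|i x _ Hx].
  by exists 1 => //; rewrite rmorph1 mulr1.
by rewrite -[0%N]/(0 + 0)%N; apply: Kinf_idealM.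
Qed.

Lemma Kinf_ideal_exp N m (x : Kinf F) : Kinf_ideal N x -> Kinf_ideal (N * m) (x ^+ m).
Proof.
move=> Hx; elim: m => [|m IH]; first by rewrite muln0; exists 1 => //; rewrite rmorph1 mulr1.
by rewrite exprS mulnS; apply: Kinf_idealM.
Qed.

Lemma power_sum_ideal d n : all (leq 1) n -> Kinf_ideal d (Kinf_of (power_sum d n)).
Proof.
move=> n0; rewrite rmorph_sum; apply: Kinf_ideal_sum => a /and3P[/allP mona].
case: n a n0 mona => [|m n] a /= n0 mona; first by rewrite tuple0.
move=> /eqP Hd _; rewrite fmorphV rmorph_prod -prodfV big_ord_recl /=.
have Hi i e : Kinf_ideal (deg (val (tnth a i)) * e)
    (Kinf_of ((val (tnth a i))%:F ^+ e))^-1.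
  rewrite rmorphXn -exprVn -fmorphV; apply: Kinf_ideal_exp.
  exact/Kinf_ideal_inv_monic/mona/mem_tnth.
apply: (@Kinf_ideal_le F d (d + 0)); first by rewrite addn0.
apply: Kinf_idealM; last first.
  by apply: Kinf_ideal_prod => i; apply: Kinf_ideal_le (Hi _ _).
apply: Kinf_ideal_le (Hi _ _).
case/tupleP: a Hd {mona Hi} => b a [Hb]; rewrite tnth0 -[X in (X <= _)%N]Hb.
by case/andP: n0 => m0 _; apply: leq_pmulr.
Qed.

Lemma power_sum_cvg n : all (leq 1) n ->
  cvgn [series Kinf_of (power_sum d n)]_d.
Proof. by move=> n0; apply: Kinf_series_cvg => d; apply: power_sum_ideal. Qed.

Lemma Xi_term_cvg k j : cvgn [series Xi_term k j d]_d.
Proof.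
apply: Kinf_series_cvg => d /=; rewrite /Xi_term rmorphM.
apply: (@Kinf_ideal_le F d (0 + d)); first by rewrite add0n.
have q1 : (1 < #|F|)%N by exact: card_finNzRing_gt1.
apply: Kinf_idealM.
  by apply: Kinf_ideal_le (power_sum_ideal d _).
apply: power_sum_ideal; rewrite /= expn_gt0 (ltnW q1) /=.
by rewrite all_map; apply/allP => i _ /=; rewrite muln_gt0 expn_gt0 (ltnW q1) subn_gt0.
Qed.

End MultipleZeta.

(* Main.v *)
From HB Require Import structures.
Require Import Defs.
From mathcomp Require Import fingroup pgroup abelian finfield ring zify.
From mathcomp Require Import all_boot all_order all_algebra.
From mathcomp Require Import all_classical topology sequences.
From mathcomp Require Import xfinmap monalg.

Set Implicit Arguments.
Unset Strict Implicit.
Unset Printing Implicit Defensive.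

Import GRing.Theory.

Local Open Scope ring_scope.

(** Write S_d(n) for the power sums, S_{<d}(n) for the sum of S_i(n) over i < d,
    and q for the cardinal of F.

    The relation already holds degree by degree. Every term of degree d contains
    the factor S_d(1), and by the q-Frobenius the other factor is built from the
    sums U_j(d) = S_d(1, q-1, ..., q^(j-1)(q-1)). These have a closed form,

       (-1)^j D_j U_j(d) = S_{d-j}(1)^(q^j),   and U_j(d) = 0 for d < j

    [staircaseE]; raising it to the power q^(k-j) turns the term of index j of
    Xi_k, up to the factor (-1)^k S_d(1) / D_k, into S_{d-j}(1)^(q^k). After
    division by this factor the relation says that the sum of y_i over i < d is
    the sum over i < d - k plus the last k terms, with y_i = S_i(1)^(q^k)
    [sum_delayed, termwise_relation].

    The closed form comes from the recursion
    (theta - theta^(q^(d+1))) U_{j+1}(d+1) = U_{j+1}(d) + U_j(d)^q, which rests on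
    two classical facts. First, (theta - theta^(q^(d+1))) S_{d+1}(1) = S_d(1): the
    sum of 1/(x + b) over deg b < d is a constant over the F-linear Carlitz
    polynomial E_d(x), and E_d(theta^d) = D_d [sum_inv_polys_lt, psum1S]. Secondly,
    S_d(n) = S_d(1)^n for 0 < n < q [psumX].

    That Xi_k lies in the span of the zeta values of weight q^k + 1 follows from
    the product formula for power sums [psumM], obtained by partial fractions in
    1/(a^m b^n) with c = b - a held fixed. In this formula S_d(m) S_d(n) involves
    only leading exponents at least 2: the terms of leading exponent 1 cancel,
    because for given c the denominators a and b run over the same monic
    polynomials. Hence Xi_k is a combination of zeta values whose first index is
    at least 2, which cannot involve zeta(1, 1, q-1, ...): the latter keeps its
    coefficient 1 in the final formal combination, so the relation is
    non-trivial. *)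

(** * Polynomials of bounded degree *)

Section Enumeration.
Variable F : finFieldType.
Local Notation A := {poly F}.

(** Enumerated by leading coefficient first, so that the step from d to d + 1 is
    a double sum over a scalar and a shorter polynomial. *)
Fixpoint polys_lt (d : nat) : seq A :=
  if d is d'.+1 then
    [seq f *: 'X^d' + b | f <- enum F, b <- polys_lt d']
  else [:: 0].

Lemma mem_polys_lt d (b : A) : (b \in polys_lt d) = (size b <= d)%N.
Proof.
elim: d b => [|d IH] b; first by rewrite inE size_poly_leq0.
apply/allpairsP/idP => [[[f c] /= [_ + ->]]|sb].
  rewrite IH => sc; apply: (leq_trans (size_polyD _ _)); rewrite geq_max.
  by rewrite (leq_trans (size_scale_leq _ _)) ?size_polyXn// leqW.
exists (b`_d, b - b`_d *: 'X^d) => /=; split; rewrite ?mem_enum//; last first.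
  by rewrite addrC subrK.
rewrite IH; apply/leq_sizeP => j; rewrite leq_eqVlt => /predU1P[<-|ltdj].
  by rewrite coefB coefZ coefXn eqxx mulr1 subrr.
rewrite coefB coefZ coefXn gtn_eqF// mulr0 subr0.
by move/leq_sizeP: sb; apply.
Qed.

Lemma uniq_polys_lt d : uniq (polys_lt d).
Proof.
elim: d => //= d IH; apply: allpairs_uniq; rewrite ?enum_uniq//.
move=> [f b] [g c] /allpairsP[[f1 b1] /= [_ + [-> ->]]].
move=> + /allpairsP[[g1 c1] /= [_ + [-> ->]]].
rewrite !mem_polys_lt => sb sc E.
have fg : f1 = g1.
  move/(congr1 (fun a : A => a`_d)): E.
  by rewrite !coefD !coefZ !coefXn eqxx !mulr1 !(nth_default 0 _)// !addr0.
by move: E; rewrite fg => /addrI->.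
Qed.

(** Translations and scalings are injective and preserve the degree bound, so they
    permute the finite enumeration: this gives the changes of variables below. *)
Lemma perm_map_polys_lt d (h : A -> A) : injective h ->
  (forall b : A, (size b <= d)%N -> (size (h b) <= d)%N) ->
  perm_eq [seq h b | b <- polys_lt d] (polys_lt d).
Proof.
move=> injh sh.
apply: uniq_perm; rewrite ?map_inj_uniq ?uniq_polys_lt//.
apply: (uniq_min_size _ _ _).2; rewrite ?map_inj_uniq ?uniq_polys_lt ?size_map//.
by move=> _ /mapP[b + ->]; rewrite !mem_polys_lt; apply: sh.
Qed.

Lemma big_polys_ltS (V : nmodType) d (h : A -> V) :
  \sum_(c <- polys_lt d.+1) h c =
  \sum_(f : F) \sum_(b <- polys_lt d) h (f *: 'X^d + b).
Proof. by rewrite big_allpairs_dep big_enum. Qed.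

Lemma scaleXn_polys_lt_eq0 d (f : F) (b : A) : (size b <= d)%N ->
  (f *: 'X^d + b == 0) = (f == 0) && (b == 0).
Proof.
move=> sb; apply/eqP/andP => [E|[/eqP-> /eqP->]]; last by rewrite scale0r addr0.
have f0 : f = 0.
  move/(congr1 (fun a : A => a`_d)): E.
  by rewrite coefD coefZ coefXn eqxx mulr1 nth_default// addr0 coef0.
by move: E; rewrite f0 scale0r add0r => ->.
Qed.

(** A nonzero polynomial is uniquely a nonzero scalar times a monic one. *)
Lemma big_polys_lt_neq0 (V : nmodType) d (h : A -> V) :
  \sum_(c <- polys_lt d | c != 0) h c =
  \sum_(0 <= i < d) \sum_(f : F | f != 0) \sum_(b <- polys_lt i)
    h (f *: ('X^i + b)).
Proof.
elim: d => [|d IH]; first by rewrite big_mkcond big_seq1 eqxx big_geq.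
rewrite big_nat_recr//= -IH big_mkcond big_polys_ltS (bigD1 0)//=; congr (_ + _).
  by rewrite [RHS]big_mkcond; apply: eq_bigr => b _; rewrite scale0r add0r.
apply: eq_bigr => f f0.
rewrite -(perm_big _ (@perm_map_polys_lt d (fun b => f *: b) _ _)) /=.
- rewrite big_map big_seq [RHS]big_seq; apply: eq_bigr => b.
  rewrite mem_polys_lt => sb; rewrite -scalerDr scaler_eq0 (negbTE f0)/=.
  by rewrite -{1}['X^d]scale1r scaleXn_polys_lt_eq0// oner_eq0.
- exact: scalerI.
- by move=> b; rewrite size_scale.
Qed.

End Enumeration.

(** * Power sums of depth one and their products *)

Section PowerSums.
Variable F : finFieldType.
Local Notation A := {poly F}.
Local Notation K := {fraction {poly F}}.

Definition fconst (x : F) : K := x%:P%:F.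
HB.instance Definition _ :=
  GRing.RMorphism.copy fconst (@FracField.tofrac A \o @polyC F).

(** This is S_d(n): the monic polynomials of degree d are the 'X^d + b with
    deg b < d. *)
Definition psum (d n : nat) : K :=
  \sum_(b <- polys_lt F d) ('X^d + b)%:F ^- n.

(** This is S_{<d}(s), the sum over chains whose degrees are all below d. *)
Fixpoint mpsum_lt (s : seq nat) (d : nat) : K :=
  if s is n :: s' then \sum_(0 <= i < d) psum i n * mpsum_lt s' i else 1.

Definition field_psum (i : nat) : F := \sum_(f | f != 0) f ^- i.

(** Multiplying the summation variable by some g with g^i <> 1 rescales the sum by
    g^-i; such g exists because 'X^i - 1 has at most i < q - 1 roots. *)
Lemma field_psum_eq0 i : (0 < i < #|F| - 1)%N -> field_psum i = 0.
Proof.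
case/andP=> i0 iq.
have [g g0 gi] : exists2 g : F, g != 0 & g ^+ i != 1.
  apply/exists_inP; apply: contraLR iq.
  rewrite negb_exists_in => /forall_inP gi1; rewrite -leqNgt.
  have p0 : ('X^i - 1 : {poly F}) != 0 by rewrite -size_poly_eq0 size_XnsubC.
  have := @max_poly_roots F _ (enum (predC1 (0 : F))) p0.
  rewrite enum_uniq -cardE cardC1 size_XnsubC// ltnS subn1; apply=> //.
  apply/allP => x; rewrite mem_enum inE => x0.
  by rewrite rootE !hornerE subr_eq0; apply/negPn/gi1.
have E : field_psum i = g ^- i * field_psum i.
  rewrite /field_psum big_distrr/= (reindex_inj (mulfI g0))/=.
  by apply: eq_big => f; rewrite ?mulf_eq0 ?(negbTE g0)// exprMn invfM.
apply/eqP; move/eqP: E; rewrite -subr_eq0 -[X in X - _]mul1r -mulrBl mulf_eq0.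
case/orP => //; rewrite subr_eq0 => /eqP E; case/negP: gi.
by rewrite -[_ ^+ _]invrK -E invr1.
Qed.

Lemma sum_shift (V : nmodType) d (c : A) (h : A -> V) : (size c <= d)%N ->
  \sum_(b <- polys_lt F d) h (b + c) = \sum_(b <- polys_lt F d) h b.
Proof.
move=> sc; rewrite -[RHS](perm_big _ (@perm_map_polys_lt F d (+%R^~ c) _ _)) ?big_map//.
  exact: addIr.
by move=> b sb; rewrite (leq_trans (size_polyD _ _))// geq_max sb.
Qed.

Lemma XnD_neq0 d (b : A) : (size b <= d)%N -> ('X^d + b)%:F != 0 :> K.
Proof.
move=> sb; rewrite tofrac_eq0 -['X^d]scale1r scaleXn_polys_lt_eq0//.
by rewrite oner_eq0.
Qed.

(** The part of S_d(m) S_d(n) that comes from the pairs of monic polynomials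
    (a, b) with b - a = c. *)
Definition shifted_psum d m n (c : A) : K :=
  \sum_(b <- polys_lt F d) ('X^d + b)%:F ^- m * ('X^d + (b + c))%:F ^- n.

Lemma partial_fraction (L : fieldType) (x y : L) m n :
  x != 0 -> y != 0 -> y - x != 0 ->
  x ^- m.+1 * y ^- n.+1 = (y - x)^-1 * (x ^- m.+1 * y ^- n - x ^- m * y ^- n.+1).
Proof.
move=> x0 y0 yx0; rewrite !exprS !invfM.
apply: (mulfI yx0); rewrite mulVKf//.
have -> : (y - x) * (x^-1 * x ^- m * (y^-1 * y ^- n)) =
   x^-1 * x ^- m * y ^- n * (y / y) - x ^- m * y^-1 * y ^- n * (x / x) by ring.
by rewrite !divff// !mulr1 mulrA.
Qed.

Lemma shifted_psumSS d m n (c : A) : c != 0 -> (size c <= d)%N ->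
  shifted_psum d m.+1 n.+1 c =
  c%:F^-1 * (shifted_psum d m.+1 n c - shifted_psum d m n.+1 c).
Proof.
move=> c0 sc; rewrite /shifted_psum -sumrB big_distrr/= big_seq [RHS]big_seq.
apply: eq_bigr => b; rewrite mem_polys_lt => sb.
have x0 := XnD_neq0 sb.
have y0 : ('X^d + (b + c))%:F != 0 :> K.
  by apply: XnD_neq0; rewrite (leq_trans (size_polyD _ _))// geq_max sb.
have yxE : 'X^d + (b + c) - ('X^d + b) = c by ring.
have -> : c%:F = ('X^d + (b + c))%:F - ('X^d + b)%:F :> K.
  by rewrite -tofracB yxE.
have : ('X^d + (b + c))%:F - ('X^d + b)%:F != 0 :> K.
  by rewrite -tofracB yxE tofrac_eq0.
by move=> xy0; rewrite (partial_fraction m n x0 y0 xy0).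
Qed.

Lemma shifted_psumr0 d m (c : A) : shifted_psum d m 0 c = psum d m.
Proof. by apply: eq_bigr => b _; rewrite expr0 invr1 mulr1. Qed.

Lemma shifted_psum0r d n (c : A) : (size c <= d)%N ->
  shifted_psum d 0 n c = psum d n.
Proof.
move=> sc; rewrite /psum -(@sum_shift _ d c)//.
by apply: eq_bigr => b _; rewrite expr0 invr1 mul1r.
Qed.

(** Induction on m + n by [shifted_psumSS]. The case m = n = 1 gives 0, as
    the two sums it produces are both S_d(1); this is the only place where S_d(1)
    could appear, so the expansion starts at j = 2. The condition on [g (m + n)]
    says that c then occurs with a positive exponent in every denominator. *)
Lemma shifted_psum_expansion m n : (1 < m + n)%N ->
  exists g : nat -> K,
   (0 < m -> 0 < n -> g (m + n) = 0%R)%N /\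
   forall d (c : A), c != 0 -> (size c <= d)%N ->
   shifted_psum d m n c =
   \sum_(2 <= j < (m + n).+1) g j * c%:F ^- (m + n - j) * psum d j.
Proof.
have single N d (c : A) : (1 < N)%N -> psum d N =
    \sum_(2 <= j < N.+1) (j == N)%:R * c%:F ^- (N - j) * psum d j.
  move=> N1; rewrite big_nat_recr//= eqxx subnn expr0 invr1 !mul1r.
  rewrite big_nat big1 ?add0r// => j /andP[_ jN].
  by rewrite ltn_eqF// !mul0r.
move E : (m + n)%N => N N1; elim: N m n E N1 => // N IH [|m] [|n] E N1 //.
- exists (fun j => (j == n.+1)%:R); split=> // d c c0 sc.
  by move: N1; rewrite shifted_psum0r// -E add0n; apply: single.
- exists (fun j => (j == m.+1)%:R); split=> // d c c0 sc.
  by move: N1; rewrite shifted_psumr0 -E addn0; apply: single.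
have [N2|N2] := ltnP 1 N; last first.
  have [-> ->] : m = 0%N /\ n = 0%N by lia.
  exists (fun=> 0); split=> // d c c0 sc.
  rewrite shifted_psumSS// shifted_psum0r// shifted_psumr0 subrr mulr0 big1// => i _.
  by rewrite !mul0r.
have [|//|g1 [_ H1]] := IH m.+1 n; first by lia.
have [|//|g2 [_ H2]] := IH m n.+1; first by lia.
exists (fun j => if (j == N.+1)%N then 0 else g1 j - g2 j).
split=> [_ _|d c c0 sc]; first by rewrite eqxx.
rewrite shifted_psumSS// H1// H2// [RHS]big_nat_recr//= eqxx !mul0r.
rewrite addr0 -sumrB big_distrr/=.
apply: eq_big_nat => j /andP[_ jN]; rewrite ltn_eqF//.
rewrite subSn// exprS invfM; ring.
Qed.

(** Sum [shifted_psum_expansion] over all c: the value c = 0 gives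
    S_d(m + n), and the nonzero c are scalar multiples of monic polynomials of
    degree < d, whence S_{<d}(m + n - j). The scalars contribute the power sum over
    F^*; keeping it explicit shows which terms vanish. *)
Lemma psumM m n : (0 < m)%N -> (0 < n)%N ->
  exists g : nat -> K, forall d, psum d m * psum d n = psum d (m + n) +
    \sum_(2 <= j < m + n) g j * fconst (field_psum (m + n - j)) * psum d j *
       mpsum_lt [:: (m + n - j)%N] d.
Proof.
move=> m0 n0; have [|g [gN Hg]] := @shifted_psum_expansion m n; first by lia.
exists g => d; rewrite {1}/psum big_distrl/=.
under eq_bigr do rewrite /psum big_distrr/=.
transitivity (\sum_(c <- polys_lt F d) shifted_psum d m n c).
  rewrite exchange_big/= /shifted_psum [RHS]exchange_big/= exchange_big/=.
  rewrite big_seq [RHS]big_seq; apply: eq_bigr => b; rewrite mem_polys_lt => sb.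
  rewrite -(sum_shift _ sb); apply: eq_bigr => c _.
  by rewrite [b + c]addrC.
rewrite (bigID (pred1 0))/=; congr (_ + _).
  rewrite (big_rem 0) ?mem_polys_lt ?size_poly0//= eqxx big1_seq ?addr0; last first.
    move=> b /andP[/eqP->].
    by rewrite mem_rem_uniq ?uniq_polys_lt// !inE eqxx.
  by apply: eq_bigr => b _; rewrite addr0 -invfM -exprD.
transitivity (\sum_(c <- polys_lt F d | c != 0)
    \sum_(2 <= j < m + n) g j * c%:F ^- (m + n - j) * psum d j).
  rewrite big_seq_cond [RHS]big_seq_cond; apply: eq_bigr => c.
  rewrite mem_polys_lt => /andP[sc c0]; rewrite Hg// big_nat_recr/=; last by lia.
  by rewrite gN// !mul0r addr0.
rewrite exchange_big/=; apply: eq_bigr => j _.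
rewrite -big_distrl -big_distrr/= -!mulrA; congr (_ * _).
rewrite [LHS]mulrC [RHS]mulrCA; congr (_ * _).
have /= -> := @big_polys_lt_neq0 F _ d (fun c : A => c%:F ^- (m + n - j) : K).
rewrite big_distrr/=.
apply: eq_bigr => i _; rewrite mulr1 /psum /field_psum rmorph_sum big_distrl/=.
apply: eq_bigr => f f0; rewrite big_distrr; apply: eq_bigr => b _ /=.
rewrite -mul_polyC tofracM exprMn invfM; congr (_ * _).
by rewrite -[f%:P%:F]/(fconst f) -rmorphXn -fmorphV.
Qed.

End PowerSums.

(** * The q-Frobenius and sums over the constant field *)

Section Frobenius.
Variable F : finFieldType.
Local Notation A := {poly F}.
Local Notation K := {fraction {poly F}}.
Local Notation q := #|F|.

Lemma card_gt1 : (1 < q)%N. Proof. exact: finNzRing_gt1. Qed.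

Lemma exprD_card (R : comNzRingType) (iota : {rmorphism F -> R}) j (x y : R) :
  (x + y) ^+ (q ^ j) = x ^+ (q ^ j) + y ^+ (q ^ j).
Proof.
have [p pr_p pF] := finPcharP F.
apply: exprDn_pchar.
rewrite (eq_pnat _ (pcharf_eq (rmorph_pchar iota pF))) pnatX.
by have /abelem_pgroup := fin_ring_pchar_abelem pF; rewrite /pgroup cardsT => ->.
Qed.

Lemma exprN_card (R : comNzRingType) (iota : {rmorphism F -> R}) j (x : R) :
  (- x) ^+ (q ^ j) = - x ^+ (q ^ j).
Proof.
apply/eqP; rewrite -addr_eq0 -(exprD_card iota) addNr expr0n.
by rewrite expn_eq0 (gtn_eqF (ltnW card_gt1)).
Qed.

Lemma exprDqK j (x y : K) : (x + y) ^+ (q ^ j) = x ^+ (q ^ j) + y ^+ (q ^ j).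
Proof. exact: (exprD_card (@fconst F)). Qed.

Lemma exprNqK j (x : K) : (- x) ^+ (q ^ j) = - x ^+ (q ^ j).
Proof. exact: (exprN_card (@fconst F)). Qed.

Lemma expr_sum_qK j (I : Type) (r : seq I) (h : I -> K) :
  (\sum_(i <- r) h i) ^+ (q ^ j) = \sum_(i <- r) h i ^+ (q ^ j).
Proof.
apply: (big_morph (fun x => x ^+ (q ^ j)) (exprDqK j)).
by rewrite expr0n expn_eq0 (gtn_eqF (ltnW card_gt1)).
Qed.

Lemma psumXq d n j : psum F d (q ^ j * n) = psum F d n ^+ (q ^ j).
Proof.
by rewrite expr_sum_qK; apply: eq_bigr => b _; rewrite mulnC exprM exprVn.
Qed.

Lemma mpsum_ltXq s d j :
  mpsum_lt F [seq (q ^ j * n)%N | n <- s] d = mpsum_lt F s d ^+ (q ^ j).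
Proof.
elim: s d => [|n s IH] d; first by rewrite expr1n.
rewrite /= expr_sum_qK; apply: eq_bigr => i _.
by rewrite psumXq IH exprMn.
Qed.

(** In the product of S_d(1) and S_d(n) with n + 1 < q, all correction terms carry
    a power sum over F^* with exponent strictly between 0 and q - 1, hence 0. *)
Lemma psumX d n : (0 < n < q)%N -> psum F d n = psum F d 1 ^+ n.
Proof.
case: n => // n; elim: n => [//|n IH] nq.
rewrite exprS -IH; last exact: ltnW.
have [//|//|g ->] := @psumM F 1 n.+1; rewrite add1n big_nat big1 ?addr0// => j Hj.
rewrite field_psum_eq0 ?rmorph0 ?mulr0 ?mul0r//.
have := nq; rewrite /=; lia.
Qed.

Lemma sum_field_expr k : (k < q)%N -> \sum_(f : F) f ^+ k = - (k == (q - 1)%N)%:R.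
Proof.
have q1 := card_gt1.
have qF : q%:R = 0 :> F.
  have [p pr_p pF] := finPcharP F; apply/eqP; rewrite -(dvdn_pcharf pF).
  have /abelem_pgroup := fin_ring_pchar_abelem pF; rewrite /pgroup cardsT.
  by move/p_natP => [[|n] qE]; [rewrite qE in q1 | rewrite qE dvdn_exp].
have unitsE : \sum_(f : F | f != 0) 1 = -1 :> F.
  rewrite sumr_const cardC1 -subn1 mulrnBr 1?ltnW// qF mulr1n sub0r//.
case: k => [|k] kq.
  rewrite (eq_bigr (fun=> 1)) => [|f _]; last by rewrite expr0.
  by rewrite sumr_const qF eq_sym subn_eq0 leqNgt card_gt1 oppr0.
rewrite (bigD1 0)//= expr0n add0r; case: eqVneq => [E|ne].
  rewrite -unitsE; apply: eq_bigr => f f0.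
  apply: (mulfI f0); rewrite mulr1 -exprS E -[(q - 1).+1]addn1 subnK ?expf_card//.
  exact: ltnW.
rewrite oppr0 -[RHS](@field_psum_eq0 F k.+1); last first.
  by rewrite /= ltn_neqAle ne -ltnS subn1 (ltn_predK q1).
rewrite /field_psum (reindex_inj invr_inj)/=.
by apply: eq_big => f; rewrite ?invr_eq0// exprVn.
Qed.

(** The polynomial Y^q - z^(q-1) Y is additive with kernel the line F z. *)
Lemma line_translate (L : fieldType) (iota : {rmorphism F -> L}) (y z : L) f :
  (y + iota f * z) ^+ q - z ^+ (q - 1) * (y + iota f * z) =
  y ^+ q - z ^+ (q - 1) * y.
Proof.
have zq : z ^+ q = z ^+ (q - 1) * z by rewrite -exprSr -addn1 subnK// ltnW ?card_gt1.
have := exprD_card iota 1 y (iota f * z); rewrite expn1 => ->.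
by rewrite exprMn -rmorphXn expf_card zq; ring.
Qed.

(** The logarithmic derivative in y of the product W = y^q - z^(q-1) y of all the
    y + f z. Since W does not change when y is replaced by y + f z, one has
    W / (y + f z) = (y + f z)^(q-1) - z^(q-1), and in the sum over f only the
    coefficient of z^(q-1) survives. *)
Lemma sum_inv_line (L : fieldType) (iota : {rmorphism F -> L}) (y z : L) :
  y ^+ q - z ^+ (q - 1) * y != 0 ->
  \sum_(f : F) (y + iota f * z)^-1 =
  - z ^+ (q - 1) / (y ^+ q - z ^+ (q - 1) * y).
Proof.
set W := _ - _ => W0; have q1 := card_gt1.
have WE f : (y + iota f * z) *
    ((y + iota f * z) ^+ (q - 1) - z ^+ (q - 1)) = W.
  rewrite mulrBr -exprS -[(q - 1).+1]addn1 subnK 1?ltnW//.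
  by rewrite [_ * z ^+ _]mulrC line_translate.
apply: (mulfI W0); rewrite mulrCA mulfV// mulr1 big_distrr/=.
transitivity (\sum_(f : F) ((y + iota f * z) ^+ (q - 1) - z ^+ (q - 1))).
  apply: eq_bigr => f _; rewrite -(WE f) mulrAC divff ?mul1r//.
  by apply: contraNneq W0 => E; rewrite -(WE f) E mul0r.
have sumf k : (k < q)%N ->
    \sum_(f : F) (iota f) ^+ k = - (k == (q - 1)%N)%:R :> L.
  move=> kq; under eq_bigr do rewrite -rmorphXn.
  by rewrite -rmorph_sum sum_field_expr// rmorphN rmorph_nat.
rewrite sumrB sumr_const.
have := sumf 0%N (ltnW q1); under eq_bigr do rewrite expr0.
rewrite sumr_const => qK; rewrite -mulr_natr qK.
rewrite [0%N == _]eq_sym subn_eq0 leqNgt q1 oppr0 mulr0 subr0.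
under eq_bigr do rewrite exprDn.
have coefE k : \sum_(f : F) y ^+ (q - 1 - k) * (iota f * z) ^+ k *+ 'C(q - 1, k) =
    y ^+ (q - 1 - k) * z ^+ k *+ 'C(q - 1, k) * \sum_(f : F) iota f ^+ k.
  rewrite big_distrr/=; apply: eq_bigr => f _.
  by rewrite exprMn mulrnAl -mulrA [_ ^+ k * _]mulrC.
rewrite exchange_big/= big_ord_recr/= big1 ?add0r => [|k _].
  by rewrite coefE sumf ?eqxx ?ltn_subrL ?(ltnW q1)// subnn binn mul1r mulrN1.
rewrite coefE sumf/=; first by rewrite ltn_eqF// oppr0 mulr0.
by rewrite (leq_trans (ltn_ord k))// leq_subr.
Qed.

End Frobenius.

(** * Carlitz polynomials and the power sums S_d(1) *)

Section CarlitzPolynomials.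
Variables (F : finFieldType) (L : fieldType) (ev : {rmorphism {poly F} -> L}).
Local Notation A := {poly F}.
Local Notation q := #|F|.
Local Notation theta := (ev 'X).
Local Notation iota := (ev \o @polyC F).
Local Notation D i := (ev (carlitzD F i)).

(** This is the product of the x + b over deg b < d, in the recursive form given by
    the kernel line of [line_translate] at each step. *)
Fixpoint carlitzE (d : nat) (x : L) : L :=
  if d is d'.+1 then
    carlitzE d' x ^+ q - D d' ^+ (q - 1) * carlitzE d' x
  else x.

Lemma exprDq (x y : L) : (x + y) ^+ q = x ^+ q + y ^+ q.
Proof. by have := exprD_card iota 1 x y; rewrite expn1. Qed.

Lemma exprBq (x y : L) : (x - y) ^+ q = x ^+ q - y ^+ q.
Proof. by rewrite exprDq; have := exprN_card iota 1 y; rewrite expn1 => ->. Qed.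

Lemma carlitzD0 : carlitzD F 0 = 1.
Proof. by rewrite /carlitzD big_geq. Qed.

Lemma carlitzDS d : D d.+1 = (theta ^+ (q ^ d.+1) - theta) * D d ^+ q.
Proof.
rewrite /carlitzD big_nat_recl// rmorphM/=; congr (_ * _).
  by rewrite expn0 expr1 rmorphB rmorphXn.
rewrite !rmorph_prod -prodrXl; apply: eq_bigr => i _ /=.
by rewrite !rmorphB exprBq -!rmorphXn -!exprM -!expnSr.
Qed.

Lemma carlitzE_linear d (f : F) x y :
  carlitzE d (x + iota f * y) = carlitzE d x + iota f * carlitzE d y.
Proof.
elim: d => //= d ->; rewrite exprDq.
by rewrite exprMn -!rmorphXn expf_card; ring.
Qed.

(** Carlitz's functional equation; at x = theta^d its first term vanishes, which
    gives the value of [carlitzE d.+1] at theta^(d+1). *)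
Lemma carlitzE_theta d x : carlitzE d.+1 (theta * x) =
  theta * carlitzE d.+1 x + (theta ^+ (q ^ d.+1) - theta) * carlitzE d x ^+ q.
Proof.
have q1 : (q - 1).+1 = q by rewrite -addn1 subnK// ltnW ?card_gt1.
elim: d => [|d IH].
  by rewrite /= carlitzD0 rmorph1 expr1n expn1 exprMn; ring.
rewrite -[LHS]/(carlitzE d.+1 (theta * x) ^+ q -
  D d.+1 ^+ (q - 1) * carlitzE d.+1 (theta * x)) IH.
rewrite -[carlitzE d.+2 x]/(carlitzE d.+1 x ^+ q -
  D d.+1 ^+ (q - 1) * carlitzE d.+1 x).
rewrite exprDq [(theta * _) ^+ q]exprMn [((_ - _) * _) ^+ q]exprMn.
rewrite [(theta ^+ _ - theta) ^+ q]exprBq -exprM -expnSr.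
have E1 : D d.+1 ^+ (q - 1) * (theta ^+ (q ^ d.+1) - theta) =
    (theta ^+ (q ^ d.+2) - theta ^+ q) * (D d ^+ (q - 1)) ^+ q.
  rewrite carlitzDS exprMn mulrAC -exprSr q1.
  by rewrite exprBq -exprM -expnSr -!exprM mulnC.
have E2 : carlitzE d.+1 x ^+ q =
   (carlitzE d x ^+ q) ^+ q - (D d ^+ (q - 1)) ^+ q * carlitzE d x ^+ q.
  by rewrite -exprMn -exprBq.
rewrite mulrDr [X in _ - (_ + X)]mulrA E1.
set a := theta ^+ _ - _; set b := D d.+1 ^+ _.
transitivity (theta ^+ q * carlitzE d.+1 x ^+ q - b * (theta * carlitzE d.+1 x)
   + a * carlitzE d.+1 x ^+ q); first by rewrite (congr1 ( *%R a) E2); ring.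
by rewrite /a; ring.
Qed.

Lemma carlitzE_Xn d : carlitzE d (theta ^+ d) = D d.
Proof.
have q1 : (q - 1).+1 = q by rewrite -addn1 subnK// ltnW ?card_gt1.
elim: d => [|d IH]; first by rewrite carlitzD0 rmorph1.
by rewrite exprS carlitzE_theta carlitzDS /= IH -exprSr q1 subrr mulr0 add0r.
Qed.

(** The coefficient of x in [carlitzE d], its derivative. *)
Definition carlitz_lin d : L := \prod_(0 <= i < d) - D i ^+ (q - 1).

(** The logarithmic derivative of an additive polynomial is its linear coefficient
    divided by the polynomial; the induction splits off the leading coefficient
    of b and uses [sum_inv_line]. *)
Lemma sum_inv_polys_lt d x : carlitzE d x != 0 ->
  \sum_(b <- polys_lt F d) (x + ev b)^-1 = carlitz_lin d / carlitzE d x.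
Proof.
elim: d x => [|d IH] x Ex.
  by rewrite big_seq1 rmorph0 addr0 /carlitz_lin big_geq// mul1r.
rewrite big_polys_ltS.
have step f : carlitzE d (x + iota f * theta ^+ d) = carlitzE d x + iota f * D d.
  by rewrite carlitzE_linear carlitzE_Xn.
have Ef f : carlitzE d (x + iota f * theta ^+ d) != 0.
  apply: contraNneq Ex; rewrite step => Ef.
  by rewrite /= -(line_translate iota _ _ f) Ef mulr0 expr0n gtn_eqF ?subr0//
    ltnW ?card_gt1.
transitivity (\sum_(f : F) carlitz_lin d / (carlitzE d x + iota f * D d)).
  apply: eq_bigr => f _; rewrite -step -IH//; apply: eq_bigr => b _.
  by rewrite -mul_polyC rmorphD rmorphM rmorphXn addrA.
rewrite -big_distrr/=; have /= -> // := @sum_inv_line F L iota (carlitzE d x) (D d).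
by rewrite /carlitz_lin big_nat_recr//= mulrA.
Qed.

Lemma sum_inv_monic d : D d != 0 ->
  \sum_(b <- polys_lt F d) (ev ('X^d + b))^-1 = carlitz_lin d / D d.
Proof.
move=> D0; rewrite -carlitzE_Xn -sum_inv_polys_lt ?carlitzE_Xn//.
by apply: eq_bigr => b _; rewrite rmorphD rmorphXn.
Qed.

End CarlitzPolynomials.

Section Evaluation.
Variable F : finFieldType.
Local Notation A := {poly F}.
Local Notation K := {fraction {poly F}}.
Local Notation q := #|F|.
Local Notation theta := (('X : A)%:F : K).

Lemma theta_pow_neq i j : i != j -> theta ^+ (q ^ i) - theta ^+ (q ^ j) != 0.
Proof.
move=> ij; rewrite -!tofracXn -tofracB tofrac_eq0 subr_eq0.
apply: contra_neq ij => /(congr1 (fun a : A => size a)).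
by rewrite !size_polyXn => -[] /eqP; rewrite eqn_exp2l ?card_gt1// => /eqP.
Qed.

Lemma carlitzD_neq0 d : carlitzD F d != 0.
Proof.
rewrite /carlitzD prodf_seq_neq0; apply/allP => j.
rewrite mem_index_iota => /andP[_ jd].
by rewrite -tofrac_eq0 tofracB !tofracXn theta_pow_neq// gtn_eqF.
Qed.

(** The recursion behind S_d(1) = 1 / l_d, where l_d is the product of the
    theta - theta^(q^i) for 1 <= i <= d. *)
Lemma psum1S d :
  (theta - theta ^+ (q ^ d.+1)) * psum F d.+1 1 = psum F d 1.
Proof.
have E m : psum F m 1 = carlitz_lin (@FracField.tofrac A) m / (carlitzD F m)%:F.
  rewrite -sum_inv_monic; last by rewrite tofrac_eq0 carlitzD_neq0.
  by apply: eq_bigr => b _; rewrite expr1.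
have D0 : (carlitzD F d)%:F != 0 :> K by rewrite tofrac_eq0 carlitzD_neq0.
have t0 : theta ^+ (q ^ d.+1) - theta != 0.
  by have := @theta_pow_neq d.+1 0 isT; rewrite expn0 expr1.
have q1 : (q - 1).+1 = q by rewrite -addn1 subnK// ltnW ?card_gt1.
have gen (M : fieldType) (l D T t : M) n : D != 0 -> T - t != 0 ->
    (t - T) * ((l * - D ^+ n) / ((T - t) * D ^+ n.+1)) = l / D.
  move=> nzD nzT; have := expf_neq0 n nzD; rewrite exprS.
  by move: (D ^+ n) => E' nzE; field; rewrite nzD nzT nzE.
rewrite !E (carlitzDS (@FracField.tofrac A)) /carlitz_lin big_nat_recr//=.
have := @gen K (carlitz_lin (@FracField.tofrac A) d) _ _ _ (q - 1)%N D0 t0.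
by rewrite q1.
Qed.

End Evaluation.

(** * Iterated power sums by recursion on the depth *)

Section IteratedSums.
Variable F : finFieldType.
Local Notation A := {poly F}.
Local Notation K := {fraction {poly F}}.

Lemma big_tuple_cons (V : nmodType) (T : finType) n (P : pred (n.+1.-tuple T))
    (h : n.+1.-tuple T -> V) :
  \sum_(a | P a) h a =
  \sum_(b : T) \sum_(t : n.-tuple T | P [tuple of b :: t]) h [tuple of b :: t].
Proof.
rewrite pair_big_dep/= (reindex (fun u : T * n.-tuple T => [tuple of u.1 :: u.2])).
  by apply: eq_bigl => -[b t].
exists (fun a => (thead a, [tuple of behead a])) => [[b t] _|a _] /=.
  by congr pair; apply: val_inj.
by rewrite [RHS]tuple_eta.
Qed.

Lemma big_npoly_monic (V : nmodType) N i (h : A -> V) : (i < N)%N ->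
  \sum_(b : {poly_N F} | (val b \is monic) && (deg (val b) == i)) h (val b) =
  \sum_(b <- polys_lt F i) h ('X^i + b).
Proof.
move=> iN.
transitivity (\sum_(b <- map val (enum {: {poly_N F}}) |
    (b \is monic) && (deg b == i)) h b); first by rewrite big_map big_enum_cond.
rewrite -[RHS](big_map (fun b : A => 'X^i + b) xpredT) -[LHS]big_filter.
apply: perm_big; apply: uniq_perm.
- by rewrite filter_uniq// map_inj_uniq ?enum_uniq//; apply: val_inj.
- by rewrite map_inj_uniq ?uniq_polys_lt//; apply: addrI.
move=> b; rewrite mem_filter; apply/andP/mapP => [[/andP[mb /eqP db] _]|[c + ->]].
  exists (b - 'X^i); last by rewrite addrC subrK.
  have sb : size b = i.+1.
    by rewrite -db prednK// lt0n size_poly_eq0 monic_neq0.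
  rewrite mem_polys_lt; apply/leq_sizeP => j; rewrite coefB coefXn leq_eqVlt.
  case/predU1P => [<-|ltij].
    by move/monicP: mb; rewrite lead_coefE sb/= => ->; rewrite eqxx subrr.
  by rewrite gtn_eqF// subr0 nth_default// sb.
rewrite mem_polys_lt => sc.
have sb : size ('X^i + c) = i.+1 by rewrite size_polyDl size_polyXn.
rewrite monicE lead_coefDl ?size_polyXn// lead_coefXn eqxx /deg sb eqxx; split=> //.
have sN : (size ('X^i + c)%R <= N)%N by rewrite sb.
apply/mapP; exists (npolyp N ('X^i + c)); first by rewrite mem_enum.
exact/esym/npolypK.
Qed.

Lemma big_npoly_monic_lt (V : nmodType) N d (h : A -> V) : (d <= N)%N ->
  \sum_(b : {poly_N F} | (val b \is monic) && (deg (val b) < d)%N) h (val b) =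
  \sum_(0 <= i < d) \sum_(b <- polys_lt F i) h ('X^i + b).
Proof.
elim: d => [|d IH] dN; first by rewrite big_geq// big_pred0// => b; rewrite andbF.
rewrite big_nat_recr//= -(IH (ltnW dN)) -(big_npoly_monic h dN) addrC.
rewrite (bigID (fun b : {poly_N F} => deg (val b) == d))/=.
by congr (_ + _); apply: eq_bigl => b; rewrite -andbA; congr (_ && _); lia.
Qed.

Definition tuple_term N (s : seq nat) (a : (size s).-tuple {poly_N F}) : K :=
  (\prod_(i < size s) (val (tnth a i))%:F ^+ nth 0%N s i)^-1.

(** The chains counted by S_{<d}, inside a type of polynomials of size at most N
    that stays the same while d decreases along the chain. *)
Definition chain_below N (d : nat) (a : seq {poly_N F}) : bool :=
  all (fun b => (val b : A) \is monic) a &&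
  path gtn d [seq deg b | b : A <- map val a].

Lemma tuple_term_cons N n s (b : {poly_N F}) (t : (size s).-tuple {poly_N F}) :
  @tuple_term N (n :: s) [tuple of b :: t] = (val b)%:F ^- n * tuple_term t.
Proof.
rewrite /tuple_term /= big_ord_recl invfM tnth0; congr (_ * _^-1).
by apply: eq_bigr => i _; rewrite tnthS.
Qed.

Lemma sum_chain_below N s d : (d <= N)%N ->
  \sum_(a : (size s).-tuple {poly_N F} | chain_below d a) tuple_term a =
  mpsum_lt F s d.
Proof.
elim: s d => [|n s IH] d dN.
  rewrite (bigD1 [tuple])//= big1 ?addr0 => [|a /andP[_]]; last by rewrite tuple0.
  by rewrite /tuple_term big_ord0 invr1.
rewrite big_tuple_cons.
transitivity (\sum_(b : {poly_N F} | (val b \is monic) && (deg (val b) < d)%N)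
    (val b)%:F ^- n * mpsum_lt F s (deg (val b))).
  rewrite [RHS]big_mkcond; apply: eq_bigr => b _.
  rewrite (eq_bigl (fun t : (size s).-tuple {poly_N F} =>
      ((val b \is monic) && (deg (val b) < d)%N) && chain_below (deg (val b)) t)).
    case: ifP => [/andP[_ bd]|_] /=; last by rewrite big_pred0.
    rewrite -IH; last exact: leq_trans (ltnW bd) dN.
    by rewrite big_distrr/=; apply: eq_bigr => t _; rewrite tuple_term_cons.
  by move=> t; rewrite /chain_below/= -!andbA; do !bool_congr.
rewrite (big_npoly_monic_lt (fun b : A => b%:F ^- n * mpsum_lt F s (deg b)) dN) /=.
apply: eq_bigr => i _; rewrite /psum big_distrl/= big_seq [RHS]big_seq.
apply: eq_bigr => b; rewrite mem_polys_lt => sb.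
by rewrite /deg size_polyDl size_polyXn.
Qed.

Lemma power_sum_cons n s d :
  power_sum F d (n :: s) = psum F d n * mpsum_lt F s d.
Proof.
rewrite /power_sum -/(tuple_term _).
rewrite big_tuple_cons.
transitivity (\sum_(b : {poly_d.+1 F} | (val b \is monic) && (deg (val b) == d))
    (val b)%:F ^- n * mpsum_lt F s d).
  rewrite [RHS]big_mkcond; apply: eq_bigr => b _.
  rewrite (eq_bigl (fun t : (size s).-tuple {poly_d.+1 F} =>
      ((val b \is monic) && (deg (val b) == d)) && chain_below d t)).
    case: ifP => [_|_] /=; last by rewrite big_pred0.
    rewrite -(sum_chain_below s (leqnSn d)).
    by rewrite big_distrr/=; apply: eq_bigr => t _; rewrite -tuple_term_cons.
  move=> t; rewrite /mzv_chain/chain_below/=.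
  have -> : (Some (deg (val b)) == Some d) = (deg (val b) == d) by [].
  by case: (eqVneq (deg _) d) => [->|_]; rewrite ?andbF ?andbT//= -!andbA.
rewrite (big_npoly_monic (fun b : A => b%:F ^- n * mpsum_lt F s d) (ltnSn d)).
by rewrite -big_distrl.
Qed.

End IteratedSums.

(** * The relation in each degree *)

Section Termwise.
Variable F : finFieldType.
Local Notation A := {poly F}.
Local Notation K := {fraction {poly F}}.
Local Notation q := #|F|.
Local Notation theta := (('X : A)%:F : K).
Local Notation D i := ((carlitzD F i)%:F : K).

Lemma q_range_shift m k :
  q_range F m (m + k) = [seq (q ^ m * n)%N | n <- q_range F 0 k].
Proof.
rewrite /q_range /index_iota addKn subn0 -map_comp -{1}[m]addn0 iotaDl -map_comp.
by apply: eq_map => i /=; rewrite expnD mulnA.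
Qed.

(** This is S_d(1, q-1, ..., q^(k-1)(q-1)), called U_k(d) above. *)
Definition staircase k d : K := psum F d 1 * mpsum_lt F (q_range F 0 k) d.

Lemma staircaseXq m k d : staircase k d ^+ (q ^ m) =
  psum F d (q ^ m) * mpsum_lt F (q_range F m (m + k)) d.
Proof. by rewrite exprMn q_range_shift mpsum_ltXq -psumXq muln1. Qed.

(** The factor on the left turns S_{d+1}(1) into S_d(1). The sum over degrees
    below d + 1 then splits into the degrees below d, giving the first term, and
    the degree d, where S_d(1) S_d(q-1) = S_d(1)^q and the other entries are q
    times those of the staircase of height k. *)
Lemma staircaseSS k d : (theta - theta ^+ (q ^ d.+1)) * staircase k.+1 d.+1 =
  staircase k.+1 d + staircase k d ^+ q.
Proof.
have q1 := card_gt1 F.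
rewrite /staircase mulrA psum1S.
have -> : q_range F 0 k.+1 = (q - 1)%N :: q_range F 1 (1 + k).
  by rewrite /q_range /index_iota subn0 addKn /= expn0 mul1n.
rewrite /= big_nat_recr//= mulrDr; congr (_ + _).
have := staircaseXq 1 k d; rewrite expn1 => ->.
have -> : psum F d q = psum F d 1 * psum F d (q - 1).
  rewrite (@psumX F d (q - 1)) ?ltn_subrL ?(ltnW q1) ?subn_gt0 ?q1//.
  rewrite -exprS -[(q - 1).+1]addn1 subnK 1?ltnW//.
  by have := @psumXq F d 1 1; rewrite expn1 muln1.
by rewrite mulrA.
Qed.

Definition delayed (V : nmodType) (y : nat -> V) (k d : nat) : V :=
  if (d < k)%N then 0 else y (d - k)%N.

Lemma delayedSS (V : nmodType) (y : nat -> V) k d :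
  delayed y k.+1 d.+1 = delayed y k d.
Proof. by rewrite /delayed ltnS subSS. Qed.

(** By induction on k and d, the recursion [staircaseSS] reduces this to the
    recursion of S_d(1) raised to the power q^(k+1). *)
Lemma staircaseE k d :
  D k * staircase k d = (-1) ^+ k * delayed (fun i => psum F i 1 ^+ (q ^ k)) k d.
Proof.
elim: k d => [|k IHk] d.
  rewrite carlitzD0 tofrac1 expr0 !mul1r /staircase /q_range /index_iota subnn /=.
  by rewrite mulr1 /delayed subn0 expn0 expr1.
elim: d => [|d IHd].
  by rewrite /staircase /= big_geq// /delayed !mulr0.
have t0 : theta - theta ^+ (q ^ d.+1) != 0.
  by have := @theta_pow_neq F 0 d.+1 isT; rewrite expn0 expr1.
apply: (mulfI t0); rewrite mulrCA staircaseSS mulrDr IHd.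
have -> : D k.+1 * staircase k d ^+ q =
    (theta ^+ (q ^ k.+1) - theta) * (D k * staircase k d) ^+ q.
  by rewrite (carlitzDS (@FracField.tofrac A)) [(D k * _) ^+ q]exprMn mulrA.
rewrite IHk exprMn.
have -> : ((-1) ^+ k) ^+ q = (-1) ^+ k :> K.
  rewrite -exprM mulnC exprM; congr (_ ^+ k).
  by have := exprNqK 1 (1 : K); rewrite expn1 expr1n.
set y := fun i => psum F i 1 ^+ (q ^ k.+1).
have -> : delayed (fun i => psum F i 1 ^+ (q ^ k)) k d ^+ q = delayed y k.+1 d.+1.
  rewrite delayedSS /delayed; case: ifP => _; last by rewrite -exprM -expnSr.
  by rewrite expr0n gtn_eqF// ltnW// card_gt1.
(* Both sides vanish for d <= k, the right one because of its first factor when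
   d = k. *)
have -> : delayed y k.+1 d =
    (theta ^+ (q ^ k.+1) - theta ^+ (q ^ d.+1)) * delayed y k.+1 d.+1.
  rewrite delayedSS /delayed ltnS; case: ltngtP => [dk|kd|->].
  - by rewrite mulr0.
  - rewrite /y -[(d - k)%N](@prednK) ?subn_gt0// -subnS.
    rewrite -(psum1S F (d - k.+1)) -subSn// exprMn; congr (_ * _).
    rewrite exprDqK exprNqK -[X in _ - X]exprM -expnD.
    by congr (_ - theta ^+ (_ ^ _)); lia.
  - by rewrite subrr mul0r.
rewrite exprS; ring.
Qed.

(** Both sums on the left are parts of the sum of the y_i over i < d: the first
    omits the last k terms and the second supplies them. *)
Lemma sum_delayed (V : nmodType) (y : nat -> V) k d :
  \sum_(0 <= i < d) delayed y k i + \sum_(1 <= j < k.+1) delayed y j d =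
  \sum_(0 <= i < d) y i.
Proof.
elim: k => [|k IH].
  by rewrite [X in _ + X]big_geq// addr0; apply: eq_bigr => i _; rewrite /delayed subn0.
rewrite big_nat_recr//= addrCA addrC -(big_nat_recr d 0 (delayed y k.+1))//.
by rewrite big_nat_recl//= [delayed y k.+1 0]/(0 : V) add0r -IH.
Qed.

Lemma termwise_relation k d :
  power_sum F d [:: 1%N, 1%N & q_range F 0 k] +
  (-1) ^+ (k + 1) / D k * power_sum F d [:: 1%N; (q ^ k)%N] +
  (D k)^-1 * \sum_(1 <= j < k.+1) (-1) ^+ (k + j) * D j ^+ (q ^ (k - j)) *
    (power_sum F d [:: 1%N]
     * power_sum F d ((q ^ (k - j))%N :: q_range F (k - j) k)) = 0.
Proof.
have D0 : D k != 0 by rewrite tofrac_eq0 carlitzD_neq0.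
rewrite !power_sum_cons /= mulr1.
set y := fun i => psum F i 1 ^+ (q ^ k).
have -> : \sum_(0 <= i < d) psum F i 1 * mpsum_lt F (q_range F 0 k) i =
    (-1) ^+ k / D k * \sum_(0 <= i < d) delayed y k i.
  rewrite big_distrr/=; apply: eq_bigr => i _.
  by rewrite mulrAC -staircaseE mulrAC divff// mul1r.
under eq_bigr do rewrite mulr1 -[(q ^ k)%N]muln1 psumXq.
rewrite -(sum_delayed y k d).
have -> : \sum_(1 <= j < k.+1) (-1) ^+ (k + j) * D j ^+ (q ^ (k - j)) *
    (psum F d 1 * power_sum F d ((q ^ (k - j))%N :: q_range F (k - j) k)) =
  (-1) ^+ k * psum F d 1 * \sum_(1 <= j < k.+1) delayed y j d.
  rewrite big_distrr/=; apply: eq_big_nat => j /andP[j1 jk].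
  have := staircaseXq (k - j) j d; rewrite power_sum_cons (subnK (ltnSE jk)) => <-.
  rewrite mulrCA -[_ * D j ^+ _ * _]mulrA -exprMn staircaseE exprMn.
  have -> : ((-1) ^+ j) ^+ (q ^ (k - j)) = (-1) ^+ j :> K.
    by rewrite -exprM mulnC exprM exprNqK expr1n.
  have -> : delayed (fun i => psum F i 1 ^+ (q ^ j)) j d ^+ (q ^ (k - j)) =
      delayed y j d.
    rewrite /delayed; case: ifP => _.
      by rewrite expr0n gtn_eqF// expn_gt0 ltnW// card_gt1.
    by rewrite -exprM -expnD subnKC// ltnSE.
  by rewrite exprD -[_ * (_ ^+ j * _)]mulrA signrMK mulrCA mulrA.
rewrite addn1 exprS; ring.
Qed.

End Termwise.

(** * Spans of iterated power sums *)

Section Spans.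
Variable F : finFieldType.
Local Notation K := {fraction {poly F}}.
Implicit Types (f : seq nat -> nat -> K) (P : pred (seq nat)) (G : nat -> K).

(** The coefficients do not depend on d, so that a relation between functions of
    the degree passes to the sums over all degrees. *)
Definition spanned f P G : Prop := exists2 l : seq (K * seq nat),
  all (fun t => P t.2) l & forall d, G d = \sum_(t <- l) t.1 * f t.2 d.

Lemma spanned_ext f P G G' : G =1 G' -> spanned f P G' -> spanned f P G.
Proof. by move=> GG' [l Pl lG]; exists l => // d; rewrite GG' lG. Qed.

Lemma spanned_gen f P s : P s -> spanned f P (f s).
Proof.
by exists [:: (1, s)] => [|d]; rewrite /= ?andbT// big_seq1 mul1r.
Qed.

Lemma spannedD f P G G' :
  spanned f P G -> spanned f P G' -> spanned f P (fun d => G d + G' d).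
Proof.
move=> [l Pl lG] [l' Pl' lG']; exists (l ++ l'); first by rewrite all_cat Pl.
by move=> d; rewrite big_cat lG lG'.
Qed.

Lemma spannedZ f P (c : K) G : spanned f P G -> spanned f P (fun d => c * G d).
Proof.
move=> [l Pl lG]; exists [seq (c * t.1, t.2) | t <- l]; first by rewrite all_map.
move=> d; rewrite big_map lG big_distrr/=; apply: eq_bigr => t _.
by rewrite mulrA.
Qed.

Lemma spanned_sum f P m n (G : nat -> nat -> K) :
  (forall j, (m <= j < n)%N -> spanned f P (G j)) ->
  spanned f P (fun d => \sum_(m <= j < n) G j d).
Proof.
elim: n => [|n IH] HG.
  by exists [::] => // d; rewrite [RHS]big_nil big_geq.
have [mn|nm] := leqP m n; last first.
  by exists [::] => // d; rewrite [RHS]big_nil big_geq.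
apply: (spanned_ext (G' := fun d => \sum_(m <= j < n) G j d + G n d)).
  by move=> d; rewrite big_nat_recr.
apply: spannedD; last by apply: HG; rewrite mn leqnn.
by apply: IH => j /andP[mj jn]; apply: HG; rewrite mj ltnW.
Qed.

Local Notation S := (fun s d => power_sum F d s).
Local Notation Slt := (mpsum_lt F).
Local Notation index_ge2 w := (fun s => mzv_index w s && (1 < head 0%N s)%N).

Lemma spanned_cons n w G P : (0 < n)%N ->
  (forall s, mzv_index w s -> P (n :: s)) ->
  spanned Slt (mzv_index w) G -> spanned S P (fun d => psum F d n * G d).
Proof.
move=> n0 HP [l Pl lG]; exists [seq (t.1, n :: t.2) | t <- l].
  by rewrite all_map; apply: sub_all Pl => t /=; apply: HP.
move=> d; rewrite big_map lG big_distrr/=; apply: eq_bigr => t _.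
by rewrite power_sum_cons mulrCA.
Qed.

Lemma spanned_sum_lt w G : (0 < w)%N -> spanned S (mzv_index w) G ->
  spanned Slt (mzv_index w) (fun d => \sum_(0 <= i < d) G i).
Proof.
move=> w0 [l Pl lG]; exists l => // d.
under eq_bigr do rewrite lG.
rewrite exchange_big/= big_seq [RHS]big_seq; apply: eq_bigr => t /(allP Pl).
case: t.2 => [|n s]; first by rewrite /mzv_index /= => /eqP E; rewrite -E in w0.
move=> _ /=.
by rewrite -big_distrr/=; under eq_bigr do rewrite power_sum_cons.
Qed.

(** Quantifying over i inside gives the induction hypothesis needed for the new
    exponents that the product formula creates. *)
Definition stuffled (s : seq nat) : Prop := forall i, (0 < i)%N ->
  spanned Slt (mzv_index (i + sumn s)) (fun d => Slt [:: i] d * Slt s d).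

(** By [psumM], the product of the two leading power sums yields S_d(m + n) and
    terms S_d(j) S_{<d}(m + n - j) with 2 <= j; the second factor is then absorbed
    into S_{<d}(s). Every leading index is at least 2, which is what makes the
    final relation non-trivial. *)
Lemma spanned_psum_mul s m n : all (leq 1) s -> stuffled s ->
  (0 < m)%N -> (0 < n)%N -> spanned S (index_ge2 (m + n + sumn s))
    (fun d => psum F d m * psum F d n * Slt s d).
Proof.
move=> s0 Hs m0 n0; have [g Hg] := psumM F m0 n0.
pose T j d := g j * fconst (field_psum F (m + n - j)) *
  (psum F d j * (Slt [:: (m + n - j)%N] d * Slt s d)).
apply: (spanned_ext (G' := fun d => S (m + n :: s)%N d + \sum_(2 <= j < m + n) T j d)).
  move=> d; rewrite Hg power_sum_cons mulrDl; congr (_ + _).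
  by rewrite big_distrl; apply: eq_bigr => j _; rewrite /T /= !mulrA.
apply: spannedD; first apply: spanned_gen.
  by rewrite /mzv_index /= s0 eqxx !andbT; lia.
apply: spanned_sum => j /andP[j2 jmn]; apply: spannedZ.
apply: (spanned_cons (w := (m + n - j + sumn s)%N)); first by lia.
  move=> r /andP[r0 /eqP rE]; rewrite /mzv_index /= r0 rE j2 !andbT.
  by apply/andP; split; lia.
by apply: Hs; lia.
Qed.

(** Split the product of two sums over degrees below d according to whether the
    first degree is larger than, smaller than or equal to the second one. *)
Lemma stuffle s : all (leq 1) s -> stuffled s.
Proof.
elim: s => [|n s IH] /= => [_|/andP[n0 s0]] i i0.
  apply: (spanned_ext (G' := Slt [:: i])); first by move=> d; rewrite /= mulr1.
  by apply: spanned_gen; rewrite /mzv_index /= i0 eqxx.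
apply: (spanned_ext (G' := fun d => \sum_(0 <= e < d)
    (S (i :: n :: s) e + psum F e n * (Slt [:: i] e * Slt s e) +
     psum F e i * psum F e n * Slt s e))).
  elim=> [|d IHd]; first by rewrite /= !big_geq// mul0r.
  rewrite [RHS]big_nat_recr//= -IHd power_sum_cons /= !big_nat_recr//=.
  by rewrite !mulr1; ring.
apply: spanned_sum_lt; first by lia.
apply: spannedD; first apply: spannedD.
- by apply: spanned_gen; rewrite /mzv_index /= i0 n0 s0 eqxx.
- apply: (spanned_cons (w := (i + sumn s)%N)) => //; last by apply: IH.
  by move=> r /andP[r0 /eqP rE]; rewrite /mzv_index /= n0 r0 rE addnCA eqxx.
- have [l Pl lG] := spanned_psum_mul s0 (IH s0) i0 n0.
  exists l => //; apply: sub_all Pl => t /andP[+ _].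
  by rewrite addnA.
Qed.

End Spans.

(** * Limits *)

Section Limits.
Local Open Scope classical_set_scope.
Variable F : finFieldType.
Local Notation K := {fraction {poly F}}.

(** Multiplication by x is continuous at 0: the loss M is the order of vanishing of
    a denominator of x. *)
Lemma Kinf_ideal_mul (x : Kinf F) : exists M, forall N (y : Kinf F),
  Kinf_ideal (N + M) y -> Kinf_ideal N (x * y).
Proof.
have d0 : \d_(repr x) != 0 by apply: denom_ratioP.
have [M [g [g0 dE]]] := fps_neq0 d0.
exists M => N _ [s _ <-]; exists (\n_(repr x) * fps_inv g * s) => //.
have gV : of_fps (fps_inv g) = (of_fps g)^-1.
  have gn : of_fps g != 0.
    by rewrite of_fps_eq0; apply: contra_neq g0 => ->; rewrite fps_coef0.
  by apply: (mulIf gn); rewrite mulVf// -rmorphM fps_mulVf// rmorph1.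
have xE : x = of_fps \n_(repr x) / (Kinf_t F ^+ M * of_fps g).
  by rewrite -rmorphXn -rmorphM -dE; apply: fracE.
rewrite [in RHS]xE !rmorphM /= gV invfM exprD.
set u := of_fps _; set v := of_fps g; set r := of_fps s.
transitivity (Kinf_t F ^+ N * (u * v^-1 * r) * (Kinf_t F ^- M * Kinf_t F ^+ M)).
  by rewrite mulVf ?expf_neq0 ?Kinf_t_neq0// mulr1.
by ring.
Qed.

Definition sums_to (u : nat -> Kinf F) (l : Kinf F) : Prop :=
  series u @ \oo --> l.

Lemma sums_to_unique u l l' : sums_to u l -> sums_to u l' -> l = l'.
Proof. exact: (cvg_unique (@Kinf_hausdorff F)). Qed.

Lemma sums_to0 : sums_to (fun=> 0) 0.
Proof.
apply/Kinf_cvgP => N; exists 0%N => n _.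
by rewrite /series/= big1// subrr; apply: Kinf_ideal0.
Qed.

Lemma sums_toD u v l m :
  sums_to u l -> sums_to v m -> sums_to (fun d => u d + v d) (l + m).
Proof.
move=> /Kinf_cvgP ul /Kinf_cvgP vm; apply/Kinf_cvgP => N.
have [M1 H1] := ul N; have [M2 H2] := vm N; exists (maxn M1 M2) => n.
rewrite geq_max => /andP[n1 n2]; rewrite /series/= big_split/= opprD addrACA.
by apply: Kinf_idealD; [apply: H1|apply: H2].
Qed.

Lemma sums_toZ (c : Kinf F) u l : sums_to u l -> sums_to (fun d => c * u d) (c * l).
Proof.
move=> /Kinf_cvgP ul; apply/Kinf_cvgP => N; have [M cM] := Kinf_ideal_mul c.
have [n0 H] := ul (N + M)%N; exists n0 => n nn0.
by rewrite /series/= -big_distrr/= -mulrBr; apply/cM/H.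
Qed.

Lemma sums_to_sum (I : eqType) (r : seq I) (u : I -> nat -> Kinf F) (l : I -> Kinf F) :
  (forall i, i \in r -> sums_to (u i) (l i)) ->
  sums_to (fun d => \sum_(i <- r) u i d) (\sum_(i <- r) l i).
Proof.
elim: r => [|i r IH] H.
  rewrite big_nil (_ : (fun d => _) = fun=> 0) ?funeqE => [|d].
    exact: sums_to0.
  by rewrite big_nil.
rewrite big_cons (_ : (fun d => _) = fun d => u i d + \sum_(j <- r) u j d); last first.
  by rewrite funeqE => d; rewrite big_cons.
apply: sums_toD; first by apply: H; rewrite mem_head.
by apply: IH => j jr; apply: H; rewrite inE jr orbT.
Qed.

Lemma sums_to_zeta n : all (leq 1) n ->
  sums_to (fun d => Kinf_of (power_sum F d n)) (zeta F n).
Proof. exact: power_sum_cvg. Qed.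

Local Notation q := #|F|.

(** The degree d part of Xi_k before the embedding in the completion, where it can
    be expanded as a combination of power sums. *)
Definition Xi_summand (k d : nat) : K :=
  ((carlitzD F k)%:F)^-1 * \sum_(1 <= j < k.+1)
    (-1) ^+ (k + j) * (carlitzD F j)%:F ^+ (q ^ (k - j)) *
    (power_sum F d [:: 1%N] *
     power_sum F d ((q ^ (k - j))%N :: q_range F (k - j) k)).

Lemma sums_to_Xi k : sums_to (fun d => Kinf_of (Xi_summand k d)) (Xi F k).
Proof.
rewrite (_ : (fun d => _) = fun d => Kinf_of ((carlitzD F k)%:F)^-1 *
   \sum_(j <- index_iota 1 k.+1)
    Kinf_of ((-1) ^+ (k + j) * (carlitzD F j)%:F ^+ (q ^ (k - j))) * Xi_term F k j d).
  apply: sums_toZ; apply: sums_to_sum => j _; apply: sums_toZ.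
  exact: Xi_term_cvg.
rewrite funeqE => d; rewrite /Xi_summand rmorphM rmorph_sum; congr (_ * _).
by apply: eq_bigr => j _; rewrite rmorphM.
Qed.

Lemma q_range_gt0 m k : all (leq 1) (q_range F m k).
Proof.
rewrite all_map; apply/allP => i _ /=.
by rewrite muln_gt0 expn_gt0 subn_gt0 card_gt1 ltnW ?card_gt1.
Qed.

(** Telescoping of q^(i+1) - q^i. *)
Lemma sumn_q_range m k : (m <= k)%N -> (q ^ m + sumn (q_range F m k) = q ^ k)%N.
Proof.
rewrite /q_range /index_iota; move/subnKC => <-; rewrite addKn.
elim: (k - m)%N => [|n IH]; first by rewrite !addn0.
rewrite -{1}[n.+1]addn1 iotaD map_cat sumn_cat addnA IH /= addn0 addnS expnS.
by rewrite mulnBr muln1 [RHS]mulnC subnKC// leq_pmulr// ltnW// card_gt1.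
Qed.

Lemma spanned_Xi_summand k :
  spanned (fun s d => power_sum F d s)
    (fun s => mzv_index (q ^ k + 1) s && (1 < head 0%N s)%N) (Xi_summand k).
Proof.
apply: spannedZ; apply: spanned_sum => j /andP[j1 jk]; apply: spannedZ.
have s0 := q_range_gt0 (k - j) k.
have qm : (0 < q ^ (k - j))%N by rewrite expn_gt0 ltnW ?card_gt1.
have [l Pl lG] := spanned_psum_mul s0 (stuffle F s0) (ltn0Sn 0) qm.
exists l; last by move=> d; rewrite -lG !power_sum_cons /= mulr1 mulrA.
apply: sub_all Pl => t /=.
by rewrite -addnA sumn_q_range ?leq_subr// addnC.
Qed.

End Limits.

Theorem theorem7p4 (p e : nat) (hp : prime p) (F : finFieldType)
    (hF : #|F| = (p ^ e)%N) (k : nat) (hk : (0 < k)%N) :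
  let q := #|F| in
  let w := (q ^ k + 1)%N in
  let n1 := [:: 1%N, 1%N & q_range F 0 k] in
  let n2 := [:: 1%N; (q ^ k)%N] in
  let c : {fraction {poly F}} := (-1) ^+ (k + 1) / (carlitzD F k)%:F in
  [/\ zeta F n1 + Kinf_of c * zeta F n2 + Xi F k = 0,
      mzv_space w (Xi F k)
    & exists2 xi : {malg {fraction {poly F}}[seq nat]},
        mzv_formal w xi /\ mzv_eval xi = Xi F k
      & mzv_nontrivial_relation w (<< 1 *g n1 >> + << c *g n2 >> + xi)].
Proof.
move=> q w n1 n2 c.
have qk0 : (0 < q ^ k)%N by rewrite expn_gt0 ltnW ?card_gt1.
have idx1 : mzv_index w n1.
  rewrite /mzv_index /w /q /= q_range_gt0 /=.
  by rewrite -(sumn_q_range F (leq0n k)) expn0 addn1 add1n eqxx.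
have idx2 : mzv_index w n2 by rewrite /mzv_index /w /= qk0 addn0 addnC eqxx.
have rel : zeta F n1 + Kinf_of c * zeta F n2 + Xi F k = 0.
  have [[n1_gt0 _] [n2_gt0 _]] := (andP idx1, andP idx2).
  apply: (@sums_to_unique F (fun d => Kinf_of (power_sum F d n1) +
    Kinf_of c * Kinf_of (power_sum F d n2) + Kinf_of (Xi_summand F k d))).
    apply: sums_toD; last exact: sums_to_Xi.
    apply: sums_toD; first exact: sums_to_zeta.
    by apply: sums_toZ; apply: sums_to_zeta.
  rewrite (_ : (fun d => _) = fun=> 0); first exact: sums_to0.
  by rewrite funeqE => d; rewrite -rmorphM -!rmorphD termwise_relation rmorph0.
have [l Pl lE] := spanned_Xi_summand F k.
pose xi : {malg {fraction {poly F}}[seq nat]} := \sum_(t <- l) << t.1 *g t.2 >>.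
(* [mzv_eval] unfolds to the linear extension [mmap] of [zeta]. *)
have evalD : {morph @mzv_eval F : a b / a + b} by exact: mmapD.
have evalU a n : mzv_eval (<< a *g n >> : {malg {fraction {poly F}}[seq nat]}) =
  Kinf_of a * zeta F n by exact: mmapU.
have eval0 : mzv_eval (0 : {malg {fraction {poly F}}[seq nat]}) = 0 by exact: mmap0.
have xiE : mzv_eval xi = Xi F k.
  rewrite /xi (big_morph _ evalD eval0).
  apply: (@sums_to_unique F (fun d => Kinf_of (Xi_summand F k d)));
    last exact: sums_to_Xi.
  rewrite (_ : (fun d => _) = fun d =>
      \sum_(t <- l) Kinf_of t.1 * Kinf_of (power_sum F d t.2)); last first.
    rewrite funeqE => d; rewrite lE rmorph_sum.
    by apply: eq_bigr => t _; rewrite rmorphM.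
  under eq_bigr do rewrite evalU.
  apply: sums_to_sum => t /(allP Pl) /andP[/andP[t0 _] _].
  by apply: sums_toZ; apply: sums_to_zeta.
have supp_xi n : n \in msupp xi -> mzv_index w n && (1 < head 0%N n)%N.
  rewrite -mcoeff_neq0 /xi raddf_sum /= => /eqP nz.
  apply/negPn/negP => nP; apply: nz; rewrite big_seq big1// => t /(allP Pl) tP.
  by rewrite mcoeffU; case: eqP => // E; move: tP; rewrite E (negbTE nP).
have formal_xi : mzv_formal w xi by move=> n /supp_xi /andP[].
split=> //; first by exists xi.
exists xi => //; split.
- move=> n /(fsubsetP (msuppD_le _ _)); rewrite in_fsetU => /orP[|/formal_xi//].
  move=> /(fsubsetP (msuppD_le _ _)); rewrite in_fsetU => /orP[].
    by move=> /(fsubsetP msuppU_le); rewrite in_fset1 => /eqP->.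
  by move=> /(fsubsetP msuppU_le); rewrite in_fset1 => /eqP->.
- apply/eqP => /(congr1 (mcoeff n1)) /eqP; rewrite !mcoeffD mcoeffUU mcoeffU.
  rewrite (_ : (n2 == n1) = false) ?mulr0n ?addr0; last first.
    rewrite /n1 /n2; case: (k) hk => // k' _.
    by rewrite /q_range /index_iota subn0 /= !eqseq_cons andbF.
  (* The coefficient of n1 is 1, as the indices in xi start with at least 2. *)
  rewrite (mcoeff_outdom (k := n1)) ?addr0 ?mcoeff0 ?oner_eq0//.
  by apply/negP => /supp_xi; rewrite andbF.
- by rewrite !evalD !evalU rmorph1 mul1r xiE.
Qed.
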